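(* Let $q$ be a prime power. Let $k\ge 1$, let $\lambda_1,\lambda_2,\ldots,\lambda_k$ be arbitrary partitions (each $\lambda_j$ is a partition of some non-negative integer, the empty partition being allowed), and let $\phi_1,\phi_2,\ldots,\phi_k\in\Phi$ be pairwise different polynomials. Then the following limit exists and has the stated value: $$\lim_{n\rightarrow\infty}\mu_n\bigl(\{\Lambda\in\mathbb{L}_n:\Lambda_{\phi_j}=\lambda_j,\ j=1,\ldots,k\}\bigr)=\prod_{j=1}^k M_{1,\,q^{\deg\phi_j}}(\lambda_j).$$
   Context: $GL(n,q)$ is the group of all invertible $n\times n$ matrices over the finite field $\mathbb{F}_q$. $\Phi$ is the set of all monic irreducible polynomials over $\mathbb{F}_q$ with nonzero constant term. Partitions: a partition $\lambda=(\lambda_1\ge\lambda_2\ge\cdots)$ has size $|\lambda|=\sum_i\lambda_i$ and is identified with its Young diagram; the empty partition has size $0$; $\lambda'$ denotes the conjugate partition. For a box $x=(i,j)\in\lambda$ the hook-length is $h(x)=\lambda_i+\lambda'_j-i-j+1$. Also $n(\lambda)=\sum_j\lambda'_j(\lambda'_j-1)/2$, so $n(\lambda')=\sum_i\lambda_i(\lambda_i-1)/2$. $\mathbb{L}_n$ is the set of collections $\Lambda=\{\Lambda_\phi\}_{\phi\in\Phi}$ of partitions indexed by $\Phi$ with $|\Lambda|:=\sum_{\phi\in\Phi}|\Lambda_\phi|\deg\phi=n$ (so all but finitely many $\Lambda_\phi$ are empty). The (complex) irreducible representations of $GL(n,q)$ are parameterized by $\mathbb{L}_n$ in the standard way (Macdonald,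 Symmetric Functions and Hall Polynomials, Ch. IV), and the degree $d_\Lambda$ of the irreducible representation corresponding to $\Lambda\in\mathbb{L}_n$ is $$d_\Lambda=\prod_{i=1}^n(q^i-1)\prod_{\phi\in\Phi}\left(q^{n(\Lambda_\phi')\deg\phi}\prod_{x\in\Lambda_\phi}\left(q^{h(x)\deg\phi}-1\right)^{-1}\right),$$ where $h(x)$ is computed in $\Lambda_\phi$. The Plancherel measure $\mu_n$ on $\mathbb{L}_n$ is defined by $$\mu_n(\Lambda)=\frac{d_\Lambda^2}{|GL(n,q)|}.$$ For real $q>1$ and $0<v<q$ (here $q$ is a generic real parameter), the measure $M_{v,q}$ on the set of all partitions of all non-negative integers is defined by $$M_{v,q}(\lambda)=\prod_{r=1}^\infty\left(1-vq^{-r}\right)^r\, q^{2n(\lambda')+|\lambda|}\prod_{x\in\lambda}\left(q^{h(x)}-1\right)^{-2}v^{|\lambda|}.$$ In the claim it is used with parameters $v=1$ and $q^{\deg\phi_j}$ in place of $q$. *)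

(* Defs.v *)
From HB Require Import structures.
From mathcomp Require Import all_boot all_order all_algebra finmap.
From mathcomp Require Import all_classical all_reals all_analysis.

Set Implicit Arguments.
Unset Strict Implicit.
Unset Printing Implicit Defensive.
Import Order.TTheory GRing.Theory Num.Theory.
Import numFieldNormedType.Exports.

Local Open Scope classical_set_scope.
Local Open Scope ring_scope.

Definition is_intpart (s : seq nat) : bool := sorted geq s && (0%N \notin s).

Record intpart := Intpart { parts :> seq nat; _ : is_intpart parts }.

HB.instance Definition _ := [isSub for parts].
HB.instance Definition _ := [Countable of intpart by <:].

Definition empty_intpart : intpart := @Intpart [::] isT.

Definition psize (la : intpart) : nat := sumn la.

(* 1-based indexing, as is customary for partitions; the value is 0 once i
   exceeds the number of parts. *)
Definition part (la : intpart) (i : nat) : nat := nth 0%N la i.-1.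

(* The j-th part (j >= 1) of the conjugate is the number of parts >= j. *)
Definition conj_parts (s : seq nat) : seq nat :=
  [seq count (leq j) s | j <- iota 1 (head 0%N s)].

Lemma conj_parts_subproof (la : intpart) : is_intpart (conj_parts la).
Proof.
case: la => s /= /andP[_ _]; apply/andP; split.
  rewrite /conj_parts sorted_map; apply: (sub_sorted _ (iota_sorted 1 _)).
  by move=> i j lij /=; apply: sub_count => x; apply: leq_trans.
apply/mapP => -[j]; rewrite mem_iota add1n ltnS => /andP[j1].
case: s => [|a s] /=; first by case: j j1.
by move=> ->.
Qed.

Definition pconj (la : intpart) : intpart := Intpart (conj_parts_subproof la).

(* The statistic n(la) is a sum over the parts of the conjugate of la. *)
Definition nstat (la : intpart) : nat :=
  (\sum_(l <- pconj la) (l * l.-1)./2)%N.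

Lemma ltn_count_leq (s : seq nat) (i j : nat) : sorted geq s -> (0 < j)%N ->
  (i < count (leq j) s)%N = (j <= nth 0%N s i)%N.
Proof.
move=> + j0; elim: s i => [|a s IH] i ss; first by rewrite nth_nil leqn0 eqn0Ngt j0.
have as' : all (geq a) s.
  by apply: order_path_min ss => x y z /= xy /leq_trans; apply.
have [ja|aj] := leqP j a.
  rewrite /= ja add1n; case: i => [|i] //=.
  by rewrite ltnS IH // (path_sorted ss).
have -> : count (leq j) (a :: s) = 0%N.
  apply/eqP; rewrite -leqn0 leqNgt -has_count; apply/hasPn => x.
  rewrite inE => /orP[/eqP->|xs]; rewrite -ltnNge //.
  exact: leq_ltn_trans (allP as' _ xs) aj.
rewrite ltn0; apply/esym/negbTE; rewrite -ltnNge; apply: leq_ltn_trans aj.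
case: (ltnP i (size (a :: s))) => [|?]; last by rewrite nth_default.
by move=> /(mem_nth 0%N); rewrite inE => /orP[/eqP->//|/(allP as')].
Qed.

Lemma pconjK : involutive pconj.
Proof.
case=> s sP; apply/val_inj => /=; rewrite /conj_parts.
move: (sP) => /andP[ss s0].
have hs : head 0%N [seq count (leq j) s | j <- iota 1 (head 0%N s)] = size s.
  have allp : all (leq 1) s.
    by apply/allP => -[|//] x0; rewrite x0 in s0.
  have [->//|] := eqVneq s [::].
  case: s s0 allp {sP ss} => // a s _ allp _.
  move: (allp); rewrite all_count => /eqP <-.
  by move: allp => /= /andP[]; case: a.
rewrite hs; apply: (@eq_from_nth _ 0%N) => [|i]; rewrite size_map size_iota // => si.
rewrite (nth_map 0%N) ?size_iota // nth_iota // add1n count_map.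
rewrite (eq_in_count (a2 := fun j => (j <= nth 0%N s i)%N)); last first.
  by move=> j; rewrite mem_iota => /andP[j1 _] /=; rewrite ltn_count_leq.
have ls : (nth 0%N s i <= head 0%N s)%N.
  case: s ss si {sP s0 hs} => // a s ss /(mem_nth 0%N).
  have as' : all (geq a) s.
    by apply: order_path_min ss => x y z /= xy /leq_trans; apply.
  by rewrite inE => /orP[/eqP->//|/(allP as')].
rewrite -(subnKC ls) iotaD count_cat.
have /eqP -> : count (fun j => (j <= nth 0 s i)%N) (iota 1 (nth 0%N s i))
    == size (iota 1 (nth 0%N s i)).
  by rewrite -all_count; apply/allP => j; rewrite mem_iota add1n ltnS => /andP[].
rewrite size_iota [X in (_ + X)%N](_ : _ = 0%N) ?addn0 //.
apply/eqP; rewrite -leqn0 leqNgt -has_count; apply/hasPn => j.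
by rewrite mem_iota -ltnNge add1n => /andP[].
Qed.

Lemma nstat_pconj (la : intpart) :
  nstat (pconj la) = (\sum_(l <- la) (l * l.-1)./2)%N.
Proof. by rewrite /nstat pconjK. Qed.

(* The truncated subtraction is exact on boxes: if (i, j) is a box of la, then
   part la i >= j and part (pconj la) j >= i. *)
Definition hook (la : intpart) (i j : nat) : nat :=
  (part la i + part (pconj la) j + 1 - i - j)%N.

Definition boxprod (R : comNzRingType) (la : intpart) (f : nat -> nat -> R) : R :=
  \prod_(1 <= i < (size la).+1) \prod_(1 <= j < (part la i).+1) f i j.

Section Collections.
Variable F : finFieldType.

Definition Phi : Type :=
  {p : {poly F} | [&& p \is monic, irreducibleb p & p`_0 != 0]}.

HB.instance Definition _ := Choice.on Phi.

Definition deg (phi : Phi) : nat := (size (val phi)).-1.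

Definition collection : Type := {fsfun Phi -> intpart with empty_intpart}.

HB.instance Definition _ := Choice.on collection.

Definition csize (La : collection) : nat :=
  (\sum_(phi <- finsupp La) psize (La phi) * deg phi)%N.

Definition LL (n : nat) : Type := {La : collection | csize La == n}.

HB.instance Definition _ n := Choice.on (LL n).

(* Unlike #|'GL_n[F]|, this is 1 (not #|F| - 1) when n = 0. *)
Definition GLorder (n : nat) : nat := #|[set A : 'M[F]_n | A \in unitmx]%SET|.

Variable R : realType.

(* The factor of phi is 1 whenever La phi is empty, so that the product over
   all of Phi is the product over the support of La. *)
Definition dim_irr (n : nat) (La : LL n) : R :=
  let q : R := #|F|%:R in
  \prod_(1 <= i < n.+1) (q ^+ i - 1) *
  \prod_(phi <- finsupp (val La))
    (q ^+ (nstat (pconj (val La phi)) * deg phi) *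
     boxprod (val La phi)
       (fun i j => (q ^+ (hook (val La phi) i j * deg phi) - 1)^-1)).

Definition plancherel_pt (n : nat) (La : LL n) : R :=
  dim_irr La ^+ 2 / (GLorder n)%:R.

Definition plancherel (n : nat) (A : set (LL n)) : \bar R :=
  \esum_(La in A) (plancherel_pt La)%:E.

End Collections.

Definition Mfactor (R : realType) (v q : R) (N : nat) : R :=
  \prod_(1 <= r < N.+1) (1 - v * q ^- r) ^+ r.

(* The limit defining the infinite product in M exists. *)
Lemma is_cvg_Mfactor (R : realType) (v q : R) :
  1 < q -> 0 < v < q -> cvgn (Mfactor v q).
Proof.
move=> q1 /andP[v0 vq].
have q0 : 0 < q by exact: lt_trans q1.
have f01 r : (0 < r)%N -> 0 <= (1 - v * q ^- r) ^+ r <= 1.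
  move=> r0; have qr : 0 < q ^+ r by rewrite exprn_gt0.
  have h0 : 0 <= 1 - v * q ^- r.
    rewrite subr_ge0 ler_pdivrMr // mul1r; apply: (le_trans (ltW vq)).
    by rewrite ler_eXnr // ltW.
  have h1 : 1 - v * q ^- r <= 1.
    by rewrite gerBl mulr_ge0 ?invr_ge0 // ltW.
  by rewrite exprn_ge0 //= exprn_ile1.
have ge0 N : 0 <= Mfactor v q N.
  rewrite /Mfactor big_nat; apply: prodr_ge0 => r /andP[r0 _].
  by case/andP: (f01 _ r0).
apply: nonincreasing_is_cvgn; last by exists 0 => _ [N _ <-].
apply/nonincreasing_seqP => N.
rewrite {1}/Mfactor big_nat_recr //= ler_piMr ?ge0 //.
by case/andP: (f01 N.+1 isT).
Qed.

Definition M (R : realType) (v q : R) (la : intpart) : R :=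
  limn (Mfactor v q) *
  q ^+ (2 * nstat (pconj la) + psize la) *
  boxprod la (fun i j => (q ^+ hook la i j - 1) ^- 2) *
  v ^+ psize la.

(* Main.v *)
Require Import Defs.
From HB Require Import structures.
From mathcomp Require Import all_boot all_order all_algebra finmap.
From mathcomp Require Import all_classical all_reals all_analysis.
From mathcomp Require Import fingroup perm.
From mathcomp Require Import ring lra zify.

Set Implicit Arguments.
Unset Strict Implicit.
Unset Printing Implicit Defensive.
Import Order.TTheory GRing.Theory Num.Theory.
Import numFieldNormedType.Exports.

Local Open Scope classical_set_scope.
Local Open Scope ring_scope.

(** Put w_Q(la) = Q^(2 n(la') + |la|) / prod_x (Q^h(x) - 1)^2 and
    pi_n = prod_(i <= n) (1 - q^-i).  The order of GL(n,q) turns the mass of a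
    collection into pi_n * prod_phi w_(q^deg phi)(La_phi) ([plancherel_ptE]),
    so the mass of the cylinder is pi_n times the coefficient of u^n in a
    product of power series, one for each phi: the monomial
    w(la_j) u^(|la_j| deg phi_j) if phi = phi_j, and
    S_Q(u^deg phi) with S_Q(u) = sum_la w_Q(la) u^|la| and Q = q^deg phi for
    all other phi ([coll_inP], [plancherel_cylinder]).

    All series other than the monomials have constant term 1 and are of the form
    exp(sum_m p_m u^m / m).  That relation is kept in its algebraic form
    n a_n = sum_(1 <= m <= n) p_m a_(n-m), called [newton p a] below; products
    of series add the p_m, and p determines a.

    - S_Q has p_m = Q^-m / (1 - Q^-m)^2 ([pweight_sum_newton]).  This is the
      Cauchy identity sum_la s_la(x) s_la(y) u^|la| = prod (1 - u x_i y_k)^-1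
      at x = y = (Q^-1, Q^-2, ...).  In N variables, the matrix
      (1 / (1 - u x_i y_k)) is, modulo a power of u, a product of two
      rectangular matrices, and Cauchy-Binet expands its determinant into
      products of two alternants, indexed by strictly decreasing exponents la_i + N - i
      ([cauchy_identity]).  At a geometric progression the alternants are
      Vandermonde determinants, and their quotients s_la tend to
      Q^n(la') / prod_x (Q^h(x) - 1) as N grows ([altdet_shifted],
      [cvg_schur_fin]).

    - The degrees of the phi in Phi with deg phi | m add up to q^m - 1
      ([sum_Phi_degrees]): unique factorization, minus the polynomial X.
      Hence the product of S_(q^deg phi)(u^deg phi) over all phi has
      p_m = (q^m - 1) q^-m / (1 - q^-m)^2 = 1 / (1 - q^-m), and these are the
      p_m of the sequence 1 / pi_n ([newton_euler_inv]).

    - Leaving out phi_1, ..., phi_k multiplies that product by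
      prod_j prod_r (1 - u^d_j q^(-r d_j))^r with d_j = deg phi_j.  The sequence
      1 / pi_n converges, and multiplication by a summable series multiplies
      the limit by the value of the series at u = 1, which here is
      prod_j prod_r (1 - q^(-r d_j))^r ([cvg_removed]).

    The factor pi_n cancels the limit of 1 / pi_n, and the values
    w(la_j) prod_r (1 - q^(-r d_j))^r that remain are the
    M_(1, q^d_j)(la_j). *)

(** * Power series given by their logarithmic derivative *)

Definition conv (R : nzRingType) (a b : nat -> R) (n : nat) : R :=
  \sum_(i < n.+1) a i * b (n - i)%N.

Definition nderiv (R : nzRingType) (a : nat -> R) (n : nat) : R :=
  n.+1%:R * a n.+1.

(** The series A of a satisfies A(0) = 1 and A' = P A, where P is the sum of the
    p_m u^(m-1), m >= 1; so A = exp(sum_m p_m u^m / m), and the p_m are the power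
    sums when the a_n are complete symmetric functions. *)
Definition newton (R : nzRingType) (p a : nat -> R) : Prop :=
  a 0%N = 1 /\ forall n, nderiv a n = conv (p \o succn) a n.

Section Sequences.
Variable R : comNzRingType.
Implicit Types (a b c p : nat -> R) (n N : nat).

(** Coefficients of index below N only see the truncations at N, so identities
    between convolutions are inherited from polynomials. *)
Lemma conv_coefM N n a b (P Q : {poly R}) : (n < N)%N ->
  (forall i, (i < N)%N -> P`_i = a i) -> (forall i, (i < N)%N -> Q`_i = b i) ->
  conv a b n = (P * Q)`_n.
Proof.
move=> nN Pa Qb; rewrite coefM; apply: eq_bigr => i _.
by rewrite Pa ?Qb //; have := ltn_ord i; lia.
Qed.

Lemma coef_trunc N a i : (i < N)%N -> (\poly_(j < N) a j)`_i = a i.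
Proof. by rewrite coef_poly => ->. Qed.

Lemma conv_trunc N n a b : (n < N)%N ->
  conv a b n = (\poly_(i < N) a i * \poly_(i < N) b i)`_n.
Proof. by move=> nN; apply: (conv_coefM nN) => i; exact: coef_trunc. Qed.

Lemma convC a b : conv a b = conv b a.
Proof.
by apply/funext => n; rewrite !(conv_trunc _ _ (ltnSn n)) mulrC.
Qed.

Lemma convA a b c : conv a (conv b c) = conv (conv a b) c.
Proof.
apply/funext => n.
pose t x : {poly R} := \poly_(i < n.+1) x i.
rewrite (@conv_coefM n.+1 n _ _ (t a) (t b * t c)) //; first last.
- by move=> i ni; rewrite (conv_trunc _ _ ni).
- by move=> i; exact: coef_trunc.
rewrite (@conv_coefM n.+1 n _ _ (t a * t b) (t c)) //; first last.
- by move=> i; exact: coef_trunc.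
- by move=> i ni; rewrite (conv_trunc _ _ ni).
by rewrite mulrA.
Qed.

Lemma convDl a b c : conv (a \+ b) c = conv a c \+ conv b c.
Proof.
apply/funext => n; rewrite /conv /= -big_split; apply: eq_bigr => i _ /=.
by rewrite mulrDl.
Qed.

(** The Leibniz rule, inherited from polynomials truncated at n + 2. *)
Lemma nderiv_conv a b :
  nderiv (conv a b) = conv (nderiv a) b \+ conv a (nderiv b).
Proof.
apply/funext => n; pose t x : {poly R} := \poly_(i < n.+2) x i.
rewrite /nderiv (conv_trunc _ _ (ltnSn n.+1)) mulr_natl -coef_deriv derivM.
rewrite coefD /=; congr (_ + _); symmetry; apply: (@conv_coefM n.+1) => // i ni.
- by rewrite coef_deriv coef_trunc // /nderiv mulr_natl.
- by rewrite coef_trunc //; lia.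
- by rewrite coef_trunc //; lia.
- by rewrite coef_deriv coef_trunc // /nderiv mulr_natl.
Qed.

Lemma newton_conv p p' a b :
  newton p a -> newton p' b -> newton (p \+ p') (conv a b).
Proof.
move=> [a0 Da] [b0 Db]; split; first by rewrite /conv big_ord1 a0 b0 mulr1.
move=> n; rewrite nderiv_conv /=.
have -> : nderiv a = conv (p \o succn) a by apply/funext.
have -> : nderiv b = conv (p' \o succn) b by apply/funext.
rewrite -[conv (conv _ _) b]convA [conv a (conv _ _)]convC -[conv (conv _ _) a]convA.
by rewrite [conv b a]convC -[LHS]/((conv _ _ \+ conv _ _) n) -convDl.
Qed.

Lemma newton_geom (z : R) : newton (fun m => z ^+ m) (fun n => z ^+ n).
Proof.
split=> // n; rewrite /nderiv /conv (eq_bigr (fun=> z ^+ n.+1)) => [|i _].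
  by rewrite sumr_const card_ord mulr_natl.
by rewrite /= -exprD addSn subnKC // -ltnS ltn_ord.
Qed.

(** The series 1 - z u. *)
Lemma newton_linear (z : R) :
  newton (fun m => - z ^+ m)
    (fun n => if n is n'.+1 then if n' is 0%N then - z else 0 else 1).
Proof.
split=> // n; rewrite /nderiv /conv big_ord_recr /= subnn mulr1.
case: n => [|n]; first by rewrite big_ord0 add0r mul1r expr1.
rewrite mulr0 big_ord_recr /= subSnn big1 => [|i _].
  by rewrite add0r mulrN mulNr opprK -exprSr subrr.
by case E: (n.+1 - i)%N => [|[|k]]; rewrite ?mulr0 //; have := ltn_ord i; lia.
Qed.

Lemma newton_scale (z : R) p a : newton p a ->
  newton (fun m => z ^+ m * p m) (fun n => z ^+ n * a n).
Proof.
move=> [a0 Da]; split; first by rewrite expr0 mul1r.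
move=> n; rewrite /nderiv mulrCA; move: (Da n); rewrite /nderiv => ->.
rewrite /conv mulr_sumr; apply: eq_bigr => i _ /=.
have -> : z ^+ n.+1 = z ^+ i.+1 * z ^+ (n - i).
  by rewrite -exprD addSn subnKC // -ltnS ltn_ord.
by ring.
Qed.

(** The substitution of u^d for u. *)
Definition dilate (d : nat) (a : nat -> R) (n : nat) : R :=
  if (d %| n)%N then a (n %/ d)%N else 0.

Lemma sum_dilate (d k : nat) (f : nat -> R) : (0 < d)%N ->
  \sum_(i < d * k) dilate d f i = \sum_(i < k) f i.
Proof.
move=> d0; elim: k => [|k IH]; first by rewrite muln0 !big_ord0.
rewrite mulnS addnC big_split_ord big_ord_recr /= IH; congr (_ + _).
case: d d0 {IH} => // d _; rewrite big_ord_recl /= addn0 big1 => [|i _].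
  by rewrite addr0 /dilate dvdn_mulr // mulKn.
by rewrite /dilate dvdn_addr ?dvdn_mulr // gtnNdvd // /bump /=; case: i => i /=; lia.
Qed.

Lemma conv_dilate (d : nat) a b : (0 < d)%N ->
  conv (dilate d a) (dilate d b) = dilate d (conv a b).
Proof.
move=> d0; apply/funext => n; rewrite {3}/dilate.
have [/dvdnP[k nk]|dn] := boolP (d %| n)%N; last first.
  rewrite /conv big1 // => i _; rewrite /dilate.
  case: ifP => [di|_]; last by rewrite mul0r.
  case: ifP => [dni|_]; last by rewrite mulr0.
  case/negP: dn; rewrite -(subnK (_ : i <= n)%N) ?dvdn_add //.
  by have := ltn_ord i; lia.
rewrite nk mulnK // mulnC /conv !big_ord_recr /= !subnn; congr (_ + _); last first.
  by rewrite /dilate dvdn_mulr // dvdn0 mulKn // div0n.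
transitivity (\sum_(i < d * k) dilate d (fun j => a j * b (k - j)%N) i);
  last exact: sum_dilate.
apply: eq_bigr => i _; rewrite /dilate; case: ifP => [/dvdnP[j ij]|_]; last by rewrite mul0r.
rewrite ij [(j * d)%N]mulnC -mulnBr dvdn_mulr // !mulKn //.
Qed.

(** The same relation for u d/du instead of d/du.  This form commutes with the
    substitution of u^d for u, up to the factor d. *)
Lemma newton_thetaP p a : newton p a <->
  a 0%N = 1 /\ forall n, n%:R * a n = conv (fun m => if m is 0%N then 0 else p m) a n.
Proof.
split=> -[a0 Da]; split=> // n.
  case: n => [|n]; first by rewrite /conv big_ord1 !mul0r.
  rewrite -[LHS]/(nderiv a n) Da /conv [RHS]big_ord_recl mul0r add0r.
  by apply: eq_bigr => i _ /=.
rewrite /nderiv Da /conv [LHS]big_ord_recl mul0r add0r.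
by apply: eq_bigr => i _ /=.
Qed.

Lemma newton_dilate (d : nat) p a : (0 < d)%N -> newton p a ->
  newton (fun m => d%:R * dilate d p m) (dilate d a).
Proof.
move=> d0 /newton_thetaP[a0 Da]; apply/newton_thetaP.
split; first by rewrite /dilate dvdn0 div0n.
move=> n; have -> : (fun m => if m is 0%N then 0 else d%:R * dilate d p m) =
    dilate d (fun m => d%:R * (if m is 0%N then 0 else p m)).
  apply/funext => -[|m]; first by rewrite /dilate dvdn0 div0n mulr0.
  rewrite /dilate; case: ifP => [/dvdnP[[//|k] ->]|_]; last by rewrite mulr0.
  by rewrite mulnK.
rewrite conv_dilate // /dilate; case: ifP => [/dvdnP[k ->]|_]; last by rewrite mulr0.
rewrite mulnK // natrM mulrC mulrA [a k * _]mulrC Da /conv mulr_suml.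
by apply: eq_bigr => i _; rewrite mulrC mulrA.
Qed.

End Sequences.

Section SequencesField.
Variable R : numFieldType.
Implicit Types (a b p : nat -> R) (n : nat).

Lemma newton_eq n p p' a b : newton p a -> newton p' b ->
  (forall i, (0 < i <= n)%N -> p i = p' i) -> a n = b n.
Proof.
move=> [a0 Da] [b0 Db]; elim/ltn_ind: n => -[|n] IH pp; first by rewrite a0 b0.
have n0 : n.+1%:R != 0 :> R by rewrite pnatr_eq0.
apply: (mulfI n0); rewrite -[LHS]/(nderiv a n) Da -[RHS]/(nderiv b n) Db.
apply: eq_bigr => i _ /=; have := ltn_ord i => ni.
rewrite pp //; congr (_ * _); apply: IH => [|j /andP[j0 jn]]; first by lia.
by apply: pp; lia.
Qed.

Fixpoint newton_prefix p n : seq R :=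
  if n is n'.+1 then
    let s := newton_prefix p n' in
    rcons s ((\sum_(i < n) p i.+1 * s`_(n' - i)) / n%:R)
  else [:: 1].

(** The relation computes a_(n+1) from a_0, ..., a_n, because n + 1 is invertible. *)
Lemma newton_exists p : exists a, newton p a.
Proof.
have sz n : size (newton_prefix p n) = n.+1.
  by elim: n => //= n IH; rewrite size_rcons IH.
pose a n := (newton_prefix p n)`_n.
have pre n i : (i <= n)%N -> (newton_prefix p n)`_i = a i.
  elim: n => [|n IH]; first by rewrite leqn0 => /eqP ->.
  by rewrite leq_eqVlt => /orP[/eqP -> //|ni]; rewrite /= nth_rcons sz ni IH.
exists a; split=> // n; rewrite /nderiv /a /= nth_rcons sz ltnn eqxx.
rewrite mulrC divfK ?pnatr_eq0 //; apply: eq_bigr => i _.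
by rewrite pre //= leq_subr.
Qed.

End SequencesField.

(** * Counting irreducible polynomials *)

Section MonicPolynomials.
Variable F : finFieldType.
Implicit Types (f g p : {poly F}) (m n : nat).

Let qF := #|F|.

Definition monics m : seq {poly F} := [seq 'X^m + val p | p : {poly_m F}].

Lemma mem_monics m f : (f \in monics m) = (f \is monic) && (size f == m.+1).
Proof.
apply/mapP/andP => [[p _ ->]|[mf /eqP sf]].
  have sp : (size (val p) < size ('X^m : {poly F}))%N by rewrite size_polyXn ltnS size_npoly.
  by rewrite monicE lead_coefDl // lead_coefXn size_polyDl // size_polyXn !eqxx.
have sg : (size (f - 'X^m)%R <= m)%N.
  apply/leq_sizeP => j mj; rewrite coefB coefXn; move: mj; rewrite leq_eqVlt.
  case/orP => [/eqP <-|mj].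
    by rewrite eqxx; move/monicP: mf; rewrite lead_coefE sf => ->; rewrite subrr.
  by rewrite gtn_eqF // nth_default ?sf // subr0.
by exists (NPoly (sg : (f - 'X^m)%R \is a poly_of_size m)); rewrite ?mem_enum //= addrC subrK.
Qed.

Lemma uniq_monics m : uniq (monics m).
Proof. by rewrite map_inj_uniq ?enum_uniq // => p p' /addrI /val_inj. Qed.

Lemma size_monics m : size (monics m) = (qF ^ m)%N.
Proof. by rewrite size_map -cardE card_npoly. Qed.

Lemma count_monic_multiples m g : g \is monic ->
  (\sum_(f <- monics m) (g %| f)%R)%N =
  (if (size g).-1 <= m then qF ^ (m - (size g).-1) else 0)%N.
Proof.
move=> mg; have g0 := monic_neq0 mg.
have sg : (size g).-1.+1 = size g by rewrite prednK // size_poly_gt0.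
have mn0 f : f \in monics m -> f != 0.
  by rewrite mem_monics => /andP[/monic_neq0].
case: leqP => [le|lt]; last first.
  rewrite big1_seq // => f /= fm; apply/eqP; rewrite eqb0; apply/negP => gf.
  have := dvdp_leq (mn0 _ fm) gf; move: fm; rewrite mem_monics => /andP[_ /eqP ->].
  by move: lt; rewrite -{2}sg /=; lia.
rewrite -size_monics -[RHS](size_map (fun h => h * g)) -big_mkcond /= sum1_count -size_filter.
apply/perm_size/uniq_perm; rewrite ?filter_uniq ?uniq_monics //.
  by rewrite map_inj_uniq ?uniq_monics //; exact: mulIf.
move=> f; rewrite mem_filter; apply/andP/mapP => [[gf fm]|[h hm ->]].
  have [h fE] := dvdpP _ _ gf; exists h => //.
  move: fm; rewrite !mem_monics => /andP[mf /eqP sf].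
  have mh : h \is monic by move: mf; rewrite fE monicMr.
  have h0 : (0 < size h)%N by rewrite size_poly_gt0 monic_neq0.
  rewrite mh; move: sf; rewrite fE size_Mmonic ?monic_neq0 // => sf.
  by apply/eqP; move: sf h0 sg le; set a := size h; set b := size g; lia.
rewrite dvdp_mull //; split=> //; move: hm; rewrite !mem_monics => /andP[mh /eqP sh].
rewrite monicMr // mh size_Mmonic ?monic_neq0 // sh.
by apply/eqP; move: sg le; set b := size g; lia.
Qed.

Definition irrs n : seq {poly F} :=
  [seq p <- [seq val p | p : {poly_n.+1 F}] | (p \is monic) && irreducibleb p].

Lemma mem_irrs n p :
  (p \in irrs n) = [&& p \is monic, irreducibleb p & (size p <= n.+1)%N].
Proof.
rewrite mem_filter -andbA; do 2 congr (_ && _).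
apply/mapP/idP => [[r _ ->]|sp]; first exact: size_npoly.
by exists (NPoly (sp : p \is a poly_of_size n.+1)); rewrite ?mem_enum.
Qed.

Lemma uniq_irrs n : uniq (irrs n).
Proof. by rewrite filter_uniq // map_inj_uniq ?enum_uniq //; exact: val_inj. Qed.

Lemma irr_size_gt1 p : irreducibleb p -> (1 < size p)%N.
Proof. by move/irreducibleP => []. Qed.

Lemma irr_deg_gt0 p : irreducibleb p -> (0 < (size p).-1)%N.
Proof. by move/irr_size_gt1; case: (size p) => [|[]]. Qed.

(** Induction on the size: a reducible polynomial has a proper divisor that is not
    constant. *)
Lemma ex_irr_divisor f : (1 < size f)%N ->
  exists p, [/\ p \is monic, irreducibleb p & p %| f].
Proof.
elim: {f}(size f) {-2}f (leqnn (size f)) => [|n IH] f fn f1; first by lia.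
have f0 : f != 0 by rewrite -size_poly_gt0; lia.
have [irrf|] := boolP (irreducibleb f).
  have l0 : (lead_coef f)^-1 != 0 by rewrite invr_eq0 lead_coef_eq0.
  exists ((lead_coef f)^-1 *: f); split; last by rewrite dvdpZl.
    by rewrite monicE lead_coefZ mulVf // lead_coef_eq0.
  move/irreducibleP: irrf => [_ irrf]; apply/irreducibleP; split; first by rewrite size_scale.
  move=> d d1; rewrite dvdpZr // => /(irrf d d1) df.
  by apply: eqp_trans df _; rewrite eqp_sym eqp_scale.
rewrite {1}/irreducibleb f1 /= negb_forall => /existsP[d].
rewrite negb_imply -Pdiv.Idomain.dvdpE -ltnNge => /andP[df d1].
have [|//|p [mp ip pd]] := IH (val d).
  by apply: leq_trans (size_npoly d) _; move: fn; case: (size f).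
by exists p; split=> //; exact: dvdp_trans df.
Qed.

Lemma irr_dvd_eq p r : p \is monic -> irreducibleb p -> r \is monic -> irreducibleb r ->
  p %| r -> p = r.
Proof.
move=> mp ip mr /irreducibleP[_ ir] pr; apply/eqP; rewrite -eqp_monic //; apply: ir => //.
by rewrite gtn_eqF // irr_size_gt1.
Qed.

Lemma size_exp_monic p i : p \is monic -> (size (p ^+ i)).-1 = ((size p).-1 * i)%N.
Proof.
move=> mp; elim: i => [|i IH]; first by rewrite size_poly1 muln0.
have mpi : p ^+ i \is monic by exact: monic_exp.
rewrite exprS size_Mmonic ?monic_neq0 // mulnS -IH.
have := monic_neq0 mp; have := monic_neq0 mpi; rewrite -!size_poly_gt0; lia.
Qed.

(** Unique factorization, as the degree formula deg f = sum_p deg p * v_p(f).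
    The multiplicity v_p(f) is the number of i >= 1 with p^i | f, so a prime factor
    p can be split off f by shifting i for p and by Gauss's lemma for the other
    irreducibles. *)
Lemma sum_multiplicity M m f : (m <= M)%N -> f \is monic -> size f = m.+1 ->
  (\sum_(p <- irrs M) (size p).-1 * \sum_(1 <= i < M.+1) (p ^+ i %| f)%R = m)%N.
Proof.
elim/ltn_ind: m f => -[|m] IH f mM mf sf.
  have f1 : f %= 1 by rewrite -size_poly_eq1 sf.
  rewrite big1_seq // => p /= ; rewrite mem_irrs => /and3P[mp ip _].
  rewrite big_nat big1 ?muln0 // => i /andP[i0 _]; apply/eqP; rewrite eqb0.
  rewrite (eqp_dvdr _ f1) dvdp1; apply/eqP => p1; have := size_exp_monic i mp.
  by have := irr_deg_gt0 ip; rewrite p1 -(ltn_pmul2r i0) mul0n /= => + e; rewrite -e.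
have [|r [mr ir rf]] := @ex_irr_divisor f; first by rewrite sf.
have [g fE] := dvdpP _ _ rf.
have r1 := irr_size_gt1 ir.
have mg : g \is monic by move: mf; rewrite fE monicMr.
have sg : size g = (m.+1 - (size r).-1).+1.
  move: sf; rewrite fE size_Mmonic ?monic_neq0 //.
  have := monic_neq0 mg; rewrite -size_poly_gt0; move: r1.
  by move: (size g) (size r) => a b; lia.
have sr : (size r <= m.+2)%N by rewrite -sf; apply: dvdp_leq => //; exact: monic_neq0.
have rM : r \in irrs M by rewrite mem_irrs mr ir (leq_trans sr).
have := IH (m.+1 - (size r).-1)%N _ g _ mg sg.
rewrite (bigD1_seq r) ?uniq_irrs //= [in X in _ -> X](bigD1_seq r) ?uniq_irrs //=.
have -> : (\sum_(p <- irrs M | p != r) (size p).-1 * \sum_(1 <= i < M.+1) (p ^+ i %| f)%R =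
  \sum_(p <- irrs M | p != r) (size p).-1 * \sum_(1 <= i < M.+1) (p ^+ i %| g)%R)%N.
  rewrite big_seq_cond [RHS]big_seq_cond; apply: eq_bigr => p /andP[+ pr].
  rewrite mem_irrs => /and3P[mp ip _]; congr (_ * _)%N; apply: eq_bigr => i _.
  rewrite fE Gauss_dvdpl // coprimep_expl // irreducible_poly_coprime; last exact/irreducibleP.
  by apply/negP => /(irr_dvd_eq mp ip mr ir)/eqP; exact/negP.
have -> : (\sum_(1 <= i < M.+1) (r ^+ i %| f)%R = 1 + \sum_(1 <= i < M.+1) (r ^+ i %| g)%R)%N.
  case: M mM {IH rM} => [|M] mM; first by [].
  have -> : (\sum_(1 <= i < M.+2) (r ^+ i %| f)%R = \sum_(0 <= i < M.+1) (r ^+ i %| g)%R)%N.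
    by rewrite big_add1 /=; apply: eq_bigr => i _; rewrite fE exprSr dvdp_mul2r // monic_neq0.
  rewrite big_nat_recl // expr0 dvd1p; congr (_ + _)%N.
  rewrite big_add1 /= [RHS]big_nat_recr //= (_ : (r ^+ M.+1 %| g) = false) ?addn0 //.
  apply/negP => /(dvdp_leq (monic_neq0 mg)); rewrite sg.
  have := size_exp_monic M.+1 mr; move: mM (irr_deg_gt0 ir).
  by move: (size (r ^+ M.+1)) ((size r).-1) => a b; nia.
move: mM sr (irr_deg_gt0 ir); rewrite -[(size r <= _)%N]/(_ <= _.+1)%N.
rewrite mulnDr muln1 -addnA => mM sr dr -> //; last 2 first.
- by move: dr; case: (size r).-1 => // a _; lia.
- by apply: leq_trans mM; exact: leq_subr.
by rewrite subnKC //; move: sr; case: (size r).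
Qed.

(** The degree formula is summed over the q^m monic f of degree m; since q^(m - i d)
    of them are multiples of p^i when d = deg p, it becomes
    m q^m = sum_(1 <= j <= m) P_j q^(m-j) with P_j the sum of the degrees
    dividing j, and P_m = q^m follows by induction. *)
Lemma sum_irr_degrees M m : (0 < m <= M)%N ->
  (\sum_(p <- irrs M | (size p).-1 %| m) (size p).-1 = qF ^ m)%N.
Proof.
elim/ltn_ind: m => -[//|m] IH /andP[_ mM].
pose d p := (size p).-1.
have d0 p : p \in irrs M -> (0 < d p)%N.
  by rewrite mem_irrs => /and3P[_ /irr_size_gt1 + _]; rewrite /d; lia.
have : (\sum_(1 <= j < m.+2) (\sum_(p <- irrs M | d p %| j) d p) * qF ^ (m.+1 - j) =
        m.+1 * qF ^ m.+1)%N.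
  transitivity (\sum_(f <- monics m.+1) \sum_(p <- irrs M)
    d p * \sum_(1 <= i < M.+1) (p ^+ i %| f)%R)%N; last first.
    rewrite (eq_big_seq (fun=> m.+1)) => [|f].
      by rewrite big_const_seq count_predT size_monics iter_addn_0 mulnC.
    by rewrite mem_monics => /andP[mf /eqP sf]; exact: sum_multiplicity.
  rewrite exchange_big /=.
  under eq_bigr do rewrite big_distrl big_mkcond /=.
  rewrite exchange_big /=; apply: eq_big_seq => p pM.
  have mp : p \is monic by move: pM; rewrite mem_irrs => /and3P[].
  rewrite -big_distrr exchange_big /= big_distrr /=.
  transitivity (\sum_(1 <= j < m.+2) \sum_(1 <= i < M.+1)
     (if (d p * i == j)%N then d p * qF ^ (m.+1 - j) else 0))%N.
    apply: eq_big_nat => j /andP[j1 jm]; have dp := d0 p pM.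
    have [/dvdnP[k jk]|dj] := boolP (d p %| j)%N; last first.
      rewrite big1 // => i _; case: eqP => // e; case/negP: dj; rewrite -e dvdn_mulr //.
    have hk : (1 <= k < M.+1)%N by apply/andP; split; nia.
    have e : (d p * k == j)%N by rewrite jk mulnC.
    rewrite (big_rem k) ?mem_index_iota //= e big1_seq ?addn0 // => i /=.
    rewrite mem_rem_uniq ?iota_uniq // inE => /andP[/negbTE /= ik _].
    by rewrite -(eqP e) eqn_pmul2l // ik.
  rewrite exchange_big /=; apply: eq_big_nat => i /andP[i1 iM].
  rewrite count_monic_multiples ?monic_exp // size_exp_monic // -/(d p).
  have dp := d0 p pM.
  case: leqP => [le|lt].
    rewrite (big_rem (d p * i)%N) ?mem_index_iota; last by apply/andP; split; nia.
    rewrite eqxx big1_seq => [|j /andP[_]]; first by rewrite /= addn0.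
    by rewrite mem_rem_uniq ?iota_uniq // inE eq_sym => /andP[/negbTE /= -> _].
  rewrite muln0 big_nat big1 // => j /andP[j1 jm]; case: eqP => //; lia.
rewrite big_nat_recr //= subnn expn0 muln1.
rewrite (eq_big_nat _ _ (F2 := fun=> (qF ^ m.+1)%N)) => [|j /andP[j1 jm]].
  by rewrite sum_nat_const_nat subn1 /= mulSn addnC => /addIn.
by rewrite IH ?j1 //= 1?ltnW // -?expnD; first (by congr (_ ^ _)%N; lia); lia.
Qed.

(** Phi lacks exactly one monic irreducible polynomial, X, of degree 1. *)
Lemma sum_Phi_degrees n m (s : seq (Phi F)) : uniq s ->
  (forall phi : Phi F, (deg phi <= n)%N -> phi \in s) -> (0 < m <= n)%N ->
  (\sum_(phi <- s | deg phi %| m) deg phi = qF ^ m - 1)%N.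
Proof.
move=> us sn hm; rewrite -(sum_irr_degrees hm).
have XM : 'X \in irrs n.
  rewrite mem_irrs monicX size_polyX; apply/and3P; split=> //; last by lia.
  by apply/irreducibleP; rewrite -['X]subr0 -polyC0; exact: irredp_XsubC.
rewrite [X in (X - 1)%N]big_mkcond (bigD1_seq 'X) ?uniq_irrs //= size_polyX dvd1n addKn.
rewrite -big_mkcondr /=.
rewrite -(big_map val (fun p : {poly F} => (size p).-1 %| m)%N (fun p : {poly F} => (size p).-1)).
rewrite -big_filter -[RHS]big_filter; apply/perm_big/uniq_perm.
- by rewrite filter_uniq // map_inj_uniq //; exact: val_inj.
- by rewrite filter_uniq // uniq_irrs.
move=> p; rewrite mem_filter [RHS]mem_filter mem_irrs [(_ != _) && _]andbC -andbA.
apply: andb_id2l => pm.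
apply/mapP/idP => [[phi _ pE]|/and4P[pX mp ip sp]].
  move: pm; rewrite {}pE => pm; case: (valP phi) => /and3P[mp ip p0].
  rewrite mp ip /=; apply/andP; split.
    apply/eqP => e; have e' : val phi = 'X := e.
    by case/negP: p0; rewrite e' coefX.
  have := dvdn_leq (andP hm).1 pm; move: (andP hm).2 => /=.
  by move=> mn am; apply: leq_trans (leqSpred _) _; rewrite ltnS (leq_trans am).
have p0 : p`_0 != 0.
  apply: contraNneq pX => p0; rewrite eq_sym; apply/eqP.
  apply: irr_dvd_eq => //; first exact: monicX.
    by apply/irreducibleP; rewrite -['X]subr0 -polyC0; exact: irredp_XsubC.
  by rewrite -['X]subr0 -polyC0 dvdp_XsubCl rootE horner_coef0 p0.
have pP : [&& p \is monic, irreducibleb p & p`_0 != 0] by rewrite mp ip.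
exists (exist _ p pP) => //; apply: sn; rewrite /deg /=.
by move: sp; case: (size p).
Qed.

End MonicPolynomials.

(** * The Cauchy identity in finitely many variables *)

Section CauchyBinet.
Variables (R : comNzRingType) (N K : nat) (A : 'M[R]_(N, K)) (B : 'M[R]_(K, N)).

Let F := {ffun 'I_N -> 'I_K}.

(** The contribution to det (A B) of choosing column f i of A in row i. *)
Definition binet_term (f : F) : R :=
  (\prod_i A i (f i)) * \det (rowsub f B).

Definition binet_weight (S : {set 'I_K}) : R :=
  \sum_(f : F | injectiveb f && (f @: [set: 'I_N] == S)%SET) binet_term f.

Lemma binet_term0 (f : F) : ~~ injectiveb f -> binet_term f = 0.
Proof.
case/injectivePn => i1 [i2 Di12 Ef12]; rewrite /binet_term.
rewrite (determinant_alternate Di12) ?mulr0 // => j.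
by rewrite !mxE Ef12.
Qed.

Lemma det_mulmx_sum : \det (A *m B) = \sum_(f : F) binet_term f.
Proof.
pose AB (s : 'S_N) i j := A i j * B j (s i).
transitivity (\sum_(f : F) \sum_(s : 'S_N) (-1) ^+ s * \prod_i AB s i (f i)).
  rewrite exchange_big; apply: eq_bigr => /= s _; rewrite -big_distrr /=.
  congr (_ * _); rewrite -(bigA_distr_bigA (AB s)) /=.
  by apply: eq_bigr => i _; rewrite mxE.
apply: eq_bigr => f _; rewrite /binet_term big_distrr /=; apply: eq_bigr => s _.
rewrite big_split /= mulrCA; congr (_ * (_ * _)).
by apply: eq_bigr => i _; rewrite mxE.
Qed.

(** Non-injective choices f contribute 0, and the others are grouped by their image. *)
Lemma cauchy_binet : \det (A *m B) = \sum_(S : {set 'I_K}) binet_weight S.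
Proof.
rewrite det_mulmx_sum (bigID (fun f : F => injectiveb f)) /= addrC big1 => [|f].
  by rewrite add0r (partition_big (fun f : F => (f @: [set: 'I_N])%SET) xpredT).
by move=> nf; rewrite binet_term0.
Qed.

(** The functions with the same image as f are the f o s for permutations s, and
    summing over s gives the second determinant. *)
Lemma binet_weight_inj (f : F) : injective f ->
  binet_weight (f @: [set: 'I_N])%SET = \det (colsub f A) * \det (rowsub f B).
Proof.
move=> injf; pose h (s : 'S_N) : F := [ffun i => f (s i)].
have injh : injective h.
  move=> s s' /ffunP ss'; apply/permP => i; apply: injf.
  by have := ss' i; rewrite !ffunE.
have -> : binet_weight (f @: [set: 'I_N])%SET = \sum_(g in (h @: [set: 'S_N])%SET) binet_term g.
  apply: eq_bigl => g; apply/andP/imsetP => [[/injectiveP injg /eqP gf]|[s _ ->]].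
    have ex i : {j | g i == f j}.
      apply: sigW; have : g i \in (f @: [set: 'I_N])%SET by rewrite -gf imset_f ?inE.
      by case/imsetP => j _ ->; exists j.
    pose t i := sval (ex i).
    have ft i : f (t i) = g i by rewrite /t; case: (ex i) => j /= /eqP.
    have injt : injective t by move=> i j /(congr1 f); rewrite !ft => /injg.
    exists (perm injt) => //; apply/ffunP => i; rewrite ffunE permE ft //.
  split; first by apply/injectiveP => i j; rewrite !ffunE => /injf /perm_inj.
  apply/eqP/setP => y; apply/imsetP/imsetP => -[i _ ->].
    by exists (s i); rewrite ?ffunE.
  by exists ((s^-1)%g i); rewrite ?ffunE ?permKV.
rewrite big_imset /=; last by move=> s s' _ _; exact: injh.
rewrite [RHS]mulr_suml; apply: eq_big => [s|s _]; first by rewrite inE.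
rewrite /binet_term.
have -> : rowsub (h s) B = row_perm s (rowsub f B).
  by apply/matrixP => i j; rewrite !mxE ffunE.
rewrite row_permE det_mulmx det_perm mulrA [_ * (-1) ^+ s]mulrC.
by congr (_ * _ * _); apply: eq_bigr => i _; rewrite !mxE ffunE.
Qed.

End CauchyBinet.

Definition eqmodX (R : nzRingType) (K : nat) (P Q : {poly R}) : Prop :=
  forall n, (n < K)%N -> P`_n = Q`_n.

Section Truncated.
Variables (R : comNzRingType) (K : nat).
Implicit Types P Q : {poly R}.

Lemma eqmodXD P P' Q Q' : eqmodX K P P' -> eqmodX K Q Q' -> eqmodX K (P + Q) (P' + Q').
Proof. by move=> h h' n nK; rewrite !coefD h ?h'. Qed.

Lemma eqmodXM P P' Q Q' : eqmodX K P P' -> eqmodX K Q Q' -> eqmodX K (P * Q) (P' * Q').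
Proof.
move=> h h' n nK; rewrite !coefM; apply: eq_bigr => i _.
by have ni := ltn_ord i; rewrite h ?h' //; lia.
Qed.

Lemma eqmodX_det N (U V : 'M[{poly R}]_N) :
  (forall i j, eqmodX K (U i j) (V i j)) -> eqmodX K (\det U) (\det V).
Proof.
move=> UV; rewrite /determinant; apply: (big_ind2 (eqmodX K)) => //.
  by move=> ? ? ? ?; exact: eqmodXD.
move=> s _; apply: eqmodXM => //; apply: (big_ind2 (eqmodX K)) => //.
by move=> ? ? ? ?; exact: eqmodXM.
Qed.

(** The series 1 / (1 - z X) modulo X^K. *)
Definition geoX (z : R) : {poly R} := \poly_(l < K) z ^+ l.

Lemma geoX_inv z : (1 - z *: 'X) * geoX z = 1 - z ^+ K *: 'X^K.
Proof.
rewrite /geoX poly_def; elim: K => [|k IH].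
  by rewrite big_ord0 mulr0 expr0 scale1r expr0 subrr.
rewrite big_ord_recr /= mulrDr IH mulrBl mul1r -scalerAl -scalerAr -exprS scalerA -exprS.
by rewrite addrA subrK.
Qed.

Lemma geoX_eqmod z : eqmodX K ((1 - z *: 'X) * geoX z) 1.
Proof.
move=> n nK; rewrite geoX_inv coefB coefZ coefXn.
by rewrite ltn_eqF // mulr0 subr0.
Qed.

(** The sequence H consists of the complete symmetric functions of the z i, whose p_m
    are the power sums. *)
Lemma prod_geoX_newton (I : Type) (r : seq I) (z : I -> R) : (0 < K)%N ->
  exists2 H, newton (fun m => \sum_(i <- r) z i ^+ m) H &
    forall n, (n < K)%N -> (\prod_(i <- r) geoX (z i))`_n = H n.
Proof.
move=> K0; elim: r => [|i r [H HN HE]].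
  exists (fun n => (n == 0%N)%:R).
    split=> // n; rewrite /nderiv mulr0 /conv big1 // => i _ /=.
    by rewrite big_nil mul0r.
  by move=> n nK; rewrite big_nil coef1.
exists (conv (fun n => z i ^+ n) H).
  have -> : (fun m => \sum_(j <- i :: r) z j ^+ m) =
    (fun m => z i ^+ m) \+ (fun m => \sum_(j <- r) z j ^+ m).
    by apply/funext => m; rewrite big_cons.
  by apply: newton_conv => //; exact: newton_geom.
move=> n nK; rewrite big_cons; symmetry; apply: (conv_coefM nK) => // j jK.
by rewrite coef_poly jK.
Qed.

End Truncated.

Section Cauchy.
Variables (R : comNzRingType) (N K : nat) (x y : 'I_N -> R).

(** The variable X records the exponent l; its powers are kept in the first factor
    only. *)
Definition left_kernel : 'M[{poly R}]_(N, K) := \matrix_(i, l) (x i ^+ l *: 'X^l).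
Definition right_kernel : 'M[{poly R}]_(K, N) := \matrix_(l, k) (y k ^+ l)%:P.
Definition cauchy_kernel : 'M[{poly R}]_N := \matrix_(i, k) geoX K (x i * y k).

Lemma cauchy_kernelE : left_kernel *m right_kernel = cauchy_kernel.
Proof.
apply/matrixP => i k; rewrite !mxE /geoX poly_def; apply: eq_bigr => l _.
by rewrite !mxE -scalerAl mulrC mul_polyC scalerA exprMn.
Qed.

Definition altdet (z : 'I_N -> R) (l : 'I_N -> nat) : R :=
  \det (\matrix_(i, j) z i ^+ l j).

Lemma det_scaled (z : 'I_N -> R) (l : 'I_N -> nat) :
  \det (\matrix_(i, j) (z i ^+ l j *: 'X^(l j)) : 'M[{poly R}]_N) =
    altdet z l *: 'X^(\sum_i l i).
Proof.
have -> : \matrix_(i, j) (z i ^+ l j *: 'X^(l j)) =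
  map_mx polyC (\matrix_(i, j) z i ^+ l j) *m diag_mx (\row_j 'X^(l j)).
  by rewrite mul_mx_diag; apply/matrixP => i j; rewrite !mxE mul_polyC.
rewrite det_mulmx det_map_mx det_diag mul_polyC -prodrXr.
by congr (_ *: _); apply: eq_bigr => i _; rewrite mxE.
Qed.

Lemma kernel_weight (f : {ffun 'I_N -> 'I_K}) : injective f ->
  binet_weight left_kernel right_kernel (f @: [set: 'I_N])%SET =
    (altdet x (fun i => f i) * altdet y (fun i => f i)) *: 'X^(\sum_i f i).
Proof.
move=> injf; rewrite binet_weight_inj //.
have -> : colsub f left_kernel = \matrix_(i, j) (x i ^+ f j *: 'X^(f j)).
  by apply/matrixP => i j; rewrite !mxE.
rewrite (det_scaled x (fun i => f i)).
have -> : rowsub f right_kernel = map_mx polyC (\matrix_(i, j) y i ^+ f j)^T.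
  by apply/matrixP => i j; rewrite !mxE.
by rewrite det_map_mx det_tr mulrC mul_polyC scalerA mulrC.
Qed.

(** The matrix with entries 1 / (1 - x_i y_k X) after row i is multiplied by
    prod_k (1 - x_i y_k X). *)
Definition cofactor_kernel : 'M[{poly R}]_N :=
  \matrix_(i, k) \prod_(k' | k' != k) (1 - (x i * y k') *: 'X).

(** Row i consists of values at x_i X of polynomials of size at most N that do not
    depend on i, so the matrix is a Vandermonde matrix in the x_i X times a matrix of
    scalars.  The constant c is a normalization, recovered from the coefficient of
    lowest degree. *)
Lemma det_cofactor_kernel : exists c : R, \det cofactor_kernel = c *: 'X^('C(N, 2)).
Proof.
pose e k : {poly R} := \prod_(k' | k' != k) (1 - y k' *: 'X).
have se k : (size (e k) <= N)%N.
  have : (size (e k) <= (\sum_(k' < N | k' != k) (2 : nat)).+1 - #|[pred k' : 'I_N | k' != k]|)%N.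
    apply: leq_trans (size_prod_leq _ _) _; rewrite leq_sub2r // ltnS.
    apply: leq_sum => k' _; apply: leq_trans (size_polyD _ _) _.
    rewrite size_poly1 size_polyN geq_max /=.
    by apply: leq_trans (size_scale_leq _ _) _; rewrite size_polyX.
  rewrite sum_nat_const cardC1 card_ord.
  by have := ltn_ord k; lia.
(* The entry of row i in column k is the value at x_i X of the polynomial e k,
   and C contains the coefficients of the e k. *)
pose C : 'M[{poly R}]_N := \matrix_(j, k) ((e k)`_j)%:P.
pose V : 'M[{poly R}]_N := \matrix_(i, j) (x i ^+ j *: 'X^j).
have -> : cofactor_kernel = V *m C.
  apply/matrixP => i k; rewrite !mxE.
  have -> : \prod_(k' | k' != k) (1 - (x i * y k') *: 'X) = e k \Po (x i *: 'X).
    rewrite /e rmorph_prod /=; apply: eq_bigr => k' _.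
    by rewrite rmorphB /= rmorph1 comp_polyZ comp_polyX scalerA mulrC.
  rewrite /comp_poly (@horner_coef_wide _ N) ?size_map_polyC //.
  by apply: eq_bigr => l _; rewrite !mxE coef_map /= exprZn mulrC.
exists (altdet x (fun j => j) * \det (\matrix_(j, k) (e k)`_j)).
rewrite det_mulmx (det_scaled x (fun j => j)).
have -> : C = map_mx polyC (\matrix_(j, k) (e k)`_j).
  by apply/matrixP => i j; rewrite !mxE.
rewrite det_map_mx mulrC mul_polyC scalerA mulrC; congr (_ *: 'X^_).
by rewrite -(big_mkord xpredT (fun i => i)) bin2_sum.
Qed.

Lemma det_kernel_eqmod : exists c : R,
  eqmodX K (\det cauchy_kernel * \prod_i \prod_k (1 - (x i * y k) *: 'X)) (c *: 'X^('C(N, 2))).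
Proof.
have [c detE] := det_cofactor_kernel; exists c; rewrite -detE.
pose d : 'rV[{poly R}]_N := \row_i \prod_k (1 - (x i * y k) *: 'X).
have -> : \det cauchy_kernel * \prod_i \prod_k (1 - (x i * y k) *: 'X) =
    \det (diag_mx d *m cauchy_kernel).
  rewrite det_mulmx det_diag mulrC; congr (_ * _).
  by apply: eq_bigr => i _; rewrite mxE.
apply: eqmodX_det => i k; rewrite mul_diag_mx !mxE (bigD1 k) //=.
rewrite mulrAC mulrC => n nK; rewrite -[in RHS](mulr1 (\prod_(_ | _) _)).
by apply: (eqmodXM _ _ nK) => //; exact: geoX_eqmod.
Qed.

Lemma power_sum_pairs :
  (fun m => \sum_(u : 'I_N * 'I_N) (x u.1 * y u.2) ^+ m) =
  (fun m => (\sum_i x i ^+ m) * (\sum_k y k ^+ m)).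
Proof.
apply/funext => m; rewrite big_distrl /=.
under [RHS]eq_bigr do rewrite big_distrr /=.
by rewrite pair_big /=; apply: eq_bigr => u _; rewrite exprMn.
Qed.

Definition altweight (S : {set 'I_K}) (m : nat) : R :=
  (binet_weight left_kernel right_kernel S)`_m.

Lemma altweight_image (f : {ffun 'I_N -> 'I_K}) m : injective f ->
  altweight (f @: [set: 'I_N])%SET m =
  if m == (\sum_i f i)%N then altdet x (fun i => f i) * altdet y (fun i => f i) else 0.
Proof.
move=> injf; rewrite /altweight kernel_weight // coefZ coefXn.
by case: eqP => _; rewrite ?mulr1 ?mulr0.
Qed.

Lemma altweight_neq0 (S : {set 'I_K}) m : altweight S m != 0 ->
  exists2 f : {ffun 'I_N -> 'I_K}, injective f & S = (f @: [set: 'I_N])%SET.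
Proof.
rewrite /altweight /binet_weight.
case: (pickP (fun f : {ffun 'I_N -> 'I_K} =>
   injectiveb f && (f @: [set: 'I_N] == S)%SET)) => [f /andP[/injectiveP fi /eqP <-] _|no].
  by exists f.
by rewrite big_pred0 // coef0 eqxx.
Qed.

(** After division by the lowest coefficient c, the left-hand side is the degree n part
    of sum_la s_la(x) s_la(y), and H n is the degree n part of
    prod (1 - x_i y_k)^-1. *)
Theorem cauchy_identity : (0 < K)%N -> exists c H,
  newton (fun m => (\sum_i x i ^+ m) * (\sum_k y k ^+ m)) H /\
  forall n, (n + 'C(N, 2) < K)%N ->
    \sum_(S : {set 'I_K}) altweight S (n + 'C(N, 2)) = c * H n.
Proof.
move=> K0; have [c Hc] := det_kernel_eqmod.
have [H HN HE] := prod_geoX_newton (index_enum ('I_N * 'I_N)%type)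
  (fun u => x u.1 * y u.2) K0.
exists c, H; split; first by rewrite -power_sum_pairs.
move=> n nK; rewrite -coef_sum -cauchy_binet cauchy_kernelE.
pose P := \prod_(u : 'I_N * 'I_N) geoX K (x u.1 * y u.2).
have -> : (\det cauchy_kernel)`_(n + 'C(N, 2)) = (c *: 'X^('C(N, 2)) * P)`_(n + 'C(N, 2)).
  have P1 : eqmodX K (\prod_i \prod_k (1 - (x i * y k) *: 'X) * P) 1.
    rewrite pair_big /= /P -big_split /=.
    apply: (big_ind (fun Q => eqmodX K Q 1)) => //.
      move=> Q Q' h h' m mK; rewrite -[in RHS](mulr1 1).
      exact: (eqmodXM h h' mK).
    by move=> u _; exact: geoX_eqmod.
  rewrite -(eqmodXM Hc (fun _ _ => erefl) nK) -mulrA.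
  by rewrite (eqmodXM (fun _ _ => erefl) P1 nK) mulr1.
rewrite -scalerAl coefZ coefXnM ltnNge leq_addl /= addnK HE //.
by apply: leq_ltn_trans nK; rewrite leq_addr.
Qed.

End Cauchy.

(** * Hook lengths *)

Lemma geq_trans : transitive geq.
Proof. by move=> x y z /= xy /leq_trans; apply. Qed.

Section Hooks.
Variable la : intpart.

Lemma intpart_sorted : sorted geq la.
Proof. by case: la => s /= /andP[]. Qed.

Lemma intpart_pos : 0%N \notin (la : seq nat).
Proof. by case: la => s /= /andP[]. Qed.

Lemma part_noninc i k : (i <= k)%N -> (nth 0%N la k <= nth 0%N la i)%N.
Proof.
move=> ik; have [kl|kl] := ltnP k (size la); last by rewrite nth_default.
have geq_trans : transitive geq by move=> x y z /= xy /leq_trans; apply.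
by apply: (sorted_leq_nth geq_trans leqnn 0%N intpart_sorted) => //;
  rewrite inE //; exact: leq_ltn_trans kl.
Qed.

(** The formula defining the conjugate parts stays valid beyond the largest part,
    where both sides are 0. *)
Lemma part_pconj j : (0 < j)%N -> part (pconj la) j = count (leq j) la.
Proof.
case: j => // j _; rewrite /part /= /conj_parts.
have [jh|hj] := ltnP j (head 0%N la).
  by rewrite (nth_map 0%N) ?size_iota // nth_iota.
rewrite nth_default ?size_map ?size_iota //; apply/esym/eqP.
rewrite -leqn0 leqNgt ltn_count_leq ?intpart_sorted // nth0.
by rewrite -ltnNge ltnS.
Qed.

Lemma ltn_pconj i j : (0 < j)%N ->
  (i < part (pconj la) j)%N = (j <= nth 0%N la i)%N.
Proof. by move=> j0; rewrite part_pconj // ltn_count_leq // intpart_sorted. Qed.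

(** The exponents la_i + N - i, i = 1, ..., N, of the alternant of la, with the index
    shifted to start at 0. *)
Definition shifted (N i : nat) : nat := (nth 0%N la i + (N - i.+1))%N.

Lemma shifted_ltn N i k : (i < k < N)%N -> (shifted N k < shifted N i)%N.
Proof.
move=> /andP[ik kN]; have := part_noninc (ltnW ik).
by rewrite /shifted; lia.
Qed.

(** Both lists are made of pairwise distinct numbers between 1 and the shifted part
    l_i, and they have la_i and N - 1 - i elements, which is l_i in total.  They are
    disjoint: h(i,j) = l_i - l_k would mean la'_j + la_k = k + j for i < k (k from 0,
    j from 1), while la'_j + la_k is at least k + j + 1 when the box (k,j) is in la
    and at most k + j - 1 otherwise. *)
Lemma hook_row_perm N i : (size la <= N)%N -> (i < N)%N ->
  perm_eq ([seq hook la i.+1 j | j <- iota 1 (nth 0%N la i)] ++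
           [seq (shifted N i - shifted N k)%N | k <- iota i.+1 (N - i.+1)])
          (iota 1 (shifted N i)).
Proof.
move=> sN iN.
have hookE j : (1 <= j < 1 + nth 0%N la i)%N ->
    hook la i.+1 j = ((nth 0%N la i - j) + (part (pconj la) j - i))%N.
  rewrite add1n ltnS => /andP[j1 ji].
  have ic : (i < part (pconj la) j)%N by rewrite ltn_pconj.
  by move: ic ji; rewrite /hook {2}/part /=; lia.
have dconj j j' : (0 < j <= j')%N -> (part (pconj la) j' <= part (pconj la) j)%N.
  move=> /andP[j0 jj']; rewrite leqNgt ltn_pconj //; last exact: leq_trans jj'.
  apply/negP => h; have := ltn_pconj (part (pconj la) j) j0.
  by rewrite ltnn (leq_trans jj' h).
set s1 := map _ _; set s2 := map _ _.
have szs : size (s1 ++ s2) = shifted N i.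
  by rewrite size_cat !size_map !size_iota.
have sub : {subset s1 ++ s2 <= iota 1 (shifted N i)}.
  move=> x; rewrite mem_cat mem_iota => /orP[] /mapP[j]; rewrite mem_iota => hj ->.
    rewrite hookE //; move: hj; rewrite add1n ltnS => /andP[j1 ji].
    have ic : (i < part (pconj la) j)%N by rewrite ltn_pconj.
    have : (part (pconj la) j <= N)%N.
      by rewrite part_pconj //; apply: leq_trans sN; exact: count_size.
    by rewrite /shifted; lia.
  have : (i < j < N)%N by lia.
  by move=> /shifted_ltn; lia.
have u1 : uniq s1.
  rewrite map_inj_in_uniq ?iota_uniq // => j j'; rewrite !mem_iota => hj hj'.
  rewrite !hookE // => e; apply/eqP; rewrite eqn_leq; apply/andP; split.
  - rewrite leqNgt; apply/negP => jj; have := @dconj j' j; have := ltn_pconj i (_ : 0 < j)%N.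
    by move=> /(_ ltac:(lia)); lia.
  - rewrite leqNgt; apply/negP => jj; have := @dconj j j'; have := ltn_pconj i (_ : 0 < j')%N.
    by move=> /(_ ltac:(lia)); lia.
have u2 : uniq s2.
  rewrite map_inj_in_uniq ?iota_uniq // => j j'; rewrite !mem_iota => hj hj' e.
  have h1 : (i < j < N)%N by lia.
  have h2 : (i < j' < N)%N by lia.
  have := shifted_ltn h1; have := shifted_ltn h2.
  move=> l1 l2; apply/eqP; rewrite eqn_leq [(j <= j')%N]leqNgt [(j' <= j)%N]leqNgt.
  apply/andP; split; apply/negP => jj.
    have : (j' < j < N)%N by lia.
    by move=> /shifted_ltn; lia.
  have : (j < j' < N)%N by lia.
  by move=> /shifted_ltn; lia.
have dis : ~~ has [in s1] s2.
  apply/hasPn => _ /mapP[k + ->]; rewrite mem_iota => hk; apply/negP => /mapP[j].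
  rewrite mem_iota => hj; rewrite hookE //.
  have h1 : (i < k < N)%N by lia.
  have := shifted_ltn h1; rewrite /shifted => hs.
  move: hj; rewrite add1n ltnS => /andP[j1 ji].
  have ic : (i < part (pconj la) j)%N by rewrite ltn_pconj.
  have := ltn_pconj k j1; have := part_noninc (ltnW (andP h1).1).
  by case: (leqP j (nth 0%N la k)); lia.
apply: uniq_perm; rewrite ?iota_uniq ?cat_uniq ?u1 ?u2 ?dis //.
have us : uniq (s1 ++ s2) by rewrite cat_uniq u1 u2 dis.
have [] := uniq_min_size us sub; first by rewrite szs size_iota.
by move=> _ eqs x; rewrite eqs.
Qed.

(** The row-by-row link between the hook product and the Vandermonde products
    of the shifted parts. *)
Lemma hook_row_prod (R : comNzRingType) (f : nat -> R) N i :
  (size la <= N)%N -> (i < N)%N ->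
  \prod_(1 <= j < (nth 0%N la i).+1) f (hook la i.+1 j) *
    \prod_(k < N | (i < k)%N) f (shifted N i - shifted N k)%N =
  \prod_(1 <= m < (shifted N i).+1) f m.
Proof.
move=> sN iN.
rewrite -(big_geq_mkord _ _ xpredT (fun k => f (shifted N i - shifted N k)%N)).
rewrite /index_iota !subSS !subn0.
rewrite -(big_map (hook la i.+1) xpredT f).
rewrite -(big_map (fun k => shifted N i - shifted N k)%N xpredT f).
by rewrite -big_cat; exact/perm_big/hook_row_perm.
Qed.

End Hooks.

(** * Schur functions at a geometric progression *)

Lemma cvg_sum_seq (R : realType) (I : Type) (r : seq I) (f : I -> nat -> R) (l : I -> R) :
  (forall i, f i n @[n --> \oo] --> l i) ->
  (\sum_(i <- r) f i n) @[n --> \oo] --> \sum_(i <- r) l i.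
Proof.
move=> fl; elim: r => [|i r IH].
  by rewrite big_nil; under eq_fun do rewrite big_nil; exact: cvg_cst.
rewrite big_cons; under eq_fun do rewrite big_cons.
exact: cvgD (fl i) IH.
Qed.

Lemma cvg_prod_seq (R : realType) (I : Type) (r : seq I) (f : I -> nat -> R) (l : I -> R) :
  (forall i, f i n @[n --> \oo] --> l i) ->
  (\prod_(i <- r) f i n) @[n --> \oo] --> \prod_(i <- r) l i.
Proof.
move=> fl; elim: r => [|i r IH].
  by rewrite big_nil; under eq_fun do rewrite big_nil; exact: cvg_cst.
rewrite big_cons; under eq_fun do rewrite big_cons.
exact: cvgM (fl i) IH.
Qed.

(** Lets a partition be padded with zero rows. *)
Lemma big_ord_rows (T : Type) (idx : T) (op : Monoid.com_law idx) (m N : nat) (F : nat -> T) :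
  (m <= N)%N -> (forall i, (m <= i)%N -> F i = idx) ->
  \big[op/idx]_(i < N) F i = \big[op/idx]_(i < m) F i.
Proof.
move=> mN Fi; rewrite [RHS](big_ord_widen N F) // [RHS]big_mkcond /=.
by apply: eq_bigr => i _; case: ltnP => // /Fi.
Qed.

Lemma boxprod_rows (R : comNzRingType) (la : intpart) (f : nat -> nat -> R) :
  boxprod la f = \prod_(i < size la) \prod_(1 <= j < (nth 0%N la i).+1) f i.+1 j.
Proof. by rewrite /boxprod big_add1 big_mkord. Qed.

Lemma nstat_pconj_rows (la : intpart) :
  nstat (pconj la) = (\sum_(i < size la) \sum_(s < nth 0%N la i) s)%N.
Proof.
rewrite nstat_pconj (big_nth 0%N) big_mkord; apply: eq_bigr => i _.
by rewrite -bin2 -bin2_sum big_mkord.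
Qed.

Section SchurSpecialization.
Variables (R : realType) (q : R).
Hypothesis q1 : 1 < q.

Let q0 : q != 0. Proof. by rewrite gt_eqF // (lt_trans _ q1). Qed.

Lemma expr_gt1 m : (0 < m)%N -> 0 < q ^+ m - 1.
Proof. by move=> m0; rewrite subr_gt0 exprn_egt1 // -lt0n. Qed.

Definition hookprod (la : intpart) : R := boxprod la (fun i j => q ^+ hook la i j - 1).

Lemma hook_gt0 (la : intpart) i j : (i < size la)%N -> (0 < j <= nth 0%N la i)%N ->
  (0 < hook la i.+1 j)%N.
Proof.
move=> il /andP[j0 ji]; have ic : (i < part (pconj la) j)%N by rewrite ltn_pconj.
by move: ic ji; rewrite /hook {2}/part /=; lia.
Qed.

Lemma hookprod_gt0 la : 0 < hookprod la.
Proof.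
rewrite /hookprod boxprod_rows; apply: prodr_gt0 => i _.
rewrite big_nat; apply: prodr_gt0 => j hj; apply: expr_gt1; exact: hook_gt0.
Qed.

(** The value of s_la at q^-1, ..., q^-N, in hook-content form. *)
Definition schur_fin (la : intpart) (N : nat) : R :=
  (\prod_(i < size la) \prod_(s < nth 0%N la i) (q ^+ s * (1 - q ^- (N - i + s)))) /
  hookprod la.

Lemma prod_gt_const N (i : 'I_N) (c : R) :
  \prod_(j < N | (i < j)%N) c = c ^+ (N - i.+1).
Proof.
by rewrite -(big_geq_mkord _ _ xpredT (fun=> c)) prodr_const_nat.
Qed.

(** At a geometric progression the alternant is a Vandermonde determinant in the
    q^-(l_j). *)
Lemma altdet_geom N (l : nat -> nat) :
  (forall i k, (i < k < N)%N -> (l k <= l i)%N) ->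
  altdet (fun i : 'I_N => q ^- i.+1) (fun i => l i) =
  \prod_(i < N) (q ^- (l i * (N - i)) *
                 \prod_(j < N | (i < j)%N) (q ^+ (l i - l j) - 1)).
Proof.
move=> ml; pose a : 'rV[R]_N := \row_j q ^- l j.
rewrite /altdet; have -> : \matrix_(i, j) (q ^- i.+1) ^+ l j =
    Vandermonde N a *m diag_mx a :> 'M[R]_N.
  rewrite mul_mx_diag; apply/matrixP => i j; rewrite !mxE.
  by rewrite -exprSr -!exprVn -!exprM mulnC.
rewrite det_mulmx det_diag det_Vandermonde -big_split /=; apply: eq_bigr => i _.
have -> : \prod_(j < N | (i < j)%N) (a 0 j - a 0 i) =
    \prod_(j < N | (i < j)%N) (a 0 i * (q ^+ (l i - l j) - 1)).
  apply: eq_bigr => j ij; rewrite !mxE mulrBr mulr1; congr (_ - _).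
  have lji : (l j <= l i)%N by apply: ml; rewrite ij ltn_ord.
  by rewrite -{1}(subnK lji) exprD invfM mulrC mulrA divff ?mul1r // expf_neq0.
rewrite big_split /= prod_gt_const mulrAC; congr (_ * _).
rewrite -exprSr mxE -exprVn -exprM -exprVn; congr (_ ^+ (_ * _)).
by have := ltn_ord i; lia.
Qed.

Let qfact (m : nat) : R := \prod_(1 <= r < m.+1) (q ^+ r - 1).

(** One row of the quotient of alternants; multiplying by q^-(d+1) turns
    q^(d+1+l) - 1 into q^l (1 - q^-(d+1+l)). *)
Lemma qfact_shift d l : q ^- ((l + d) * d.+1) * qfact (l + d) =
  q ^- (d * d.+1) * qfact d * \prod_(s < l) (q ^+ s * (1 - q ^- (d.+1 + s))).
Proof.
elim: l => [|l IH]; first by rewrite big_ord0 mulr1.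
rewrite big_ord_recr /= [RHS]mulrA -IH addSn mulSn exprD invfM /qfact big_nat_recr //=.
rewrite [LHS](_ : _ = q ^- ((l + d) * d.+1) * qfact (l + d) *
  (q ^- d.+1 * (q ^+ (l + d).+1 - 1))); last by rewrite /qfact; ring.
congr (_ * _); have -> : q ^+ (l + d).+1 = q ^+ d.+1 * q ^+ l.
  by rewrite -exprD; congr (_ ^+ _); lia.
rewrite mulrBr mulr1 mulrA mulVf ?expf_neq0 // mul1r mulrBr mulr1; congr (_ - _).
by rewrite exprD invfM mulrCA divff ?mulr1 // expf_neq0.
Qed.

(** The bialternant formula; the alternant of the empty partition is the denominator. *)
Lemma altdet_shifted (la : intpart) N : (size la <= N)%N ->
  altdet (fun i : 'I_N => q ^- i.+1) (fun i => shifted la N i) =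
  altdet (fun i : 'I_N => q ^- i.+1) (fun i => shifted empty_intpart N i) *
  schur_fin la N.
Proof.
move=> sN.
have noninc (mu : intpart) i k : (i < k < N)%N -> (shifted mu N k <= shifted mu N i)%N.
  by move=> ik; exact/ltnW/shifted_ltn.
have row (mu : intpart) (i : 'I_N) : (size mu <= N)%N ->
  \prod_(1 <= j < (nth 0%N mu i).+1) (q ^+ hook mu i.+1 j - 1) *
    \prod_(k < N | (i < k)%N) (q ^+ (shifted mu N i - shifted mu N k) - 1)
  = qfact (shifted mu N i).
  by move=> sm; rewrite (hook_row_prod (fun m => q ^+ m - 1)).
rewrite !altdet_geom; try exact: noninc.
rewrite /schur_fin mulrA; apply: (canRL (mulfK _)); first by rewrite gt_eqF // hookprod_gt0.
rewrite /hookprod boxprod_rows.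
pose H i := \prod_(1 <= j < (nth 0%N la i).+1) (q ^+ hook la i.+1 j - 1).
pose T i := \prod_(s < nth 0%N la i) (q ^+ s * (1 - q ^- (N - i + s))).
rewrite -(big_ord_rows _ (F := H) sN) => [|i si]; last by rewrite /H nth_default // big_nil.
rewrite -(big_ord_rows _ (F := T) sN) => [|i si]; last by rewrite /T nth_default // big_ord0.
rewrite -!big_split /=; apply: eq_bigr => i _.
have := row empty_intpart i; rewrite nth_nil big_nil mul1r => -> //.
rewrite -mulrA [X in _ * X]mulrC row // /shifted nth_nil add0n /T.
have -> : (N - i = (N - i.+1).+1)%N by have := ltn_ord i; lia.
by rewrite qfact_shift.
Qed.

Lemma cvg_schur_fin la :
  schur_fin la N @[N --> \oo] --> q ^+ nstat (pconj la) / hookprod la.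
Proof.
apply: cvgM; last exact: cvg_cst.
rewrite nstat_pconj_rows -prodrXr; apply: cvg_prod_seq => i.
rewrite -prodrXr; apply: cvg_prod_seq => s.
rewrite -[X in _ --> X]mulr1; apply: cvgM; first exact: cvg_cst.
rewrite -[X in _ --> X]subr0; apply: cvgB; first exact: cvg_cst.
have -> : (fun N => q ^- (N - i + s)) = (fun N => (q^-1 ^+ s) * (fun n => q^-1 ^+ n) (N - i)%N).
  by apply/funext => N; rewrite /= addnC -exprVn exprD.
rewrite -[X in _ --> X](mulr0 (q^-1 ^+ s)); apply: cvgM; first exact: cvg_cst.
rewrite (cvg_centern i (fun n => q^-1 ^+ n)).
apply: cvg_expr; rewrite ger0_norm ?invr_ge0 ?invf_lt1 //; have := q1; lra.
Qed.

End SchurSpecialization.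

(** * Partitions and strictly decreasing exponents *)

Lemma intpart_eq (la mu : intpart) :
  (forall i, nth 0%N la i = nth 0%N mu i) -> la = mu.
Proof.
move=> nth_eq; apply: val_inj => /=.
have le (a b : intpart) : (forall i, nth 0%N a i = nth 0%N b i) -> (size a <= size b)%N.
  move=> ab; rewrite leqNgt; apply/negP => ba; have := intpart_pos a.
  by rewrite -(nth_default 0%N (leqnn (size b))) -ab mem_nth.
apply: (@eq_from_nth _ 0%N) => // ; apply/eqP; rewrite eqn_leq.
by rewrite !le // => i; rewrite nth_eq.
Qed.

Definition mkpart (s : seq nat) : intpart := insubd empty_intpart [seq x <- s | (0 < x)%N].

(** Removing the zeros of a nonincreasing sequence only shortens its tail. *)
Lemma nth_mkpart s i : sorted geq s -> nth 0%N (mkpart s) i = nth 0%N s i.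
Proof.
move=> ss; rewrite /mkpart val_insubd; set u := [seq x <- s | _].
have -> : is_intpart u.
  rewrite /is_intpart sorted_filter //=; last exact: geq_trans.
  by rewrite mem_filter.
rewrite {}/u; elim: s i ss => //= a s IH i ss; have ss' := path_sorted ss.
case: ltnP => [a0|]; first by case: i => //= i; exact: IH.
rewrite leqn0 => /eqP a0; have as0 : all (geq a) s.
  by apply: order_path_min ss; exact: geq_trans.
have -> : s = nseq (size s) 0%N.
  by apply/all_pred1P/allP => x /(allP as0) /=; rewrite a0 leqn0.
rewrite (_ : seq.filter _ _ = [::]); last by elim: (size s).
by rewrite nth_nil; case: i => //= i; rewrite nth_nseq if_same.
Qed.

Lemma psize_nth (la : intpart) N : (size la <= N)%N -> psize la = (\sum_(i < N) nth 0%N la i)%N.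
Proof.
move=> sN; rewrite /psize sumnE (big_nth 0%N) big_mkord.
by rewrite (big_ord_rows _ (F := nth 0%N la) sN) // => i /(nth_default 0%N).
Qed.

Lemma size_psize (la : intpart) : (size la <= psize la)%N.
Proof.
have := intpart_pos la; rewrite /psize; elim: (parts la) => //= a s IH.
by rewrite inE negb_or => /andP[a0 /IH]; lia.
Qed.

Lemma nth_psize (la : intpart) i : (nth 0%N la i <= psize la)%N.
Proof.
have [il|] := ltnP i (size la); last by move=> /(nth_default 0%N) ->.
by rewrite (psize_nth (leqnn _)) (bigD1 (Ordinal il)) //= leq_addr.
Qed.

(** A partition of n has at most n parts, all at most n; it is listed as an n-tuple
    padded with zeros. *)
Definition intparts (n : nat) : seq intpart :=
  undup [seq la <- [seq mkpart (map val (tval t)) | t : n.-tuple 'I_n.+1] | psize la == n].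

Lemma intparts_uniq n : uniq (intparts n).
Proof. exact: undup_uniq. Qed.

Lemma mem_intparts n la : (la \in intparts n) = (psize la == n).
Proof.
rewrite /intparts mem_undup mem_filter; apply: andb_idr => /eqP sn.
have slan : (size la <= n)%N by rewrite -sn size_psize.
have lan i : (nth 0%N la i < n.+1)%N by rewrite ltnS -sn nth_psize.
apply/mapP; exists [tuple inord (nth 0%N la i) | i < n].
  by rewrite mem_enum inE.
set s := map val _; have szs : size s = n by rewrite size_map size_tuple.
have nths i : nth 0%N s i = nth 0%N la i.
  have [ni|ni] := ltnP i n; last by rewrite !nth_default ?szs // (leq_trans slan).
  rewrite (nth_map ord0) ?size_tuple // -(tnth_nth _ _ (Ordinal ni)) tnth_mktuple.
  by rewrite /= inordK.
apply: intpart_eq => i; rewrite nth_mkpart ?nths //.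
apply/(sortedP 0%N) => j _; rewrite !nths /=; exact: part_noninc.
Qed.

Lemma gtn_trans : transitive gtn.
Proof. by move=> x y z /= xy yz; exact: ltn_trans yz xy. Qed.

(** A strictly decreasing sequence dominates the staircase, so that subtracting the
    staircase is exact in the natural numbers. *)
Lemma staircase_leq v i : sorted gtn v -> (i < size v)%N ->
  (size v - i.+1 <= nth 0%N v i)%N.
Proof.
elim: v i => //= a v IH i sv; have sv' := path_sorted sv.
case: i => [|i] iv /=; last by have := IH i sv' iv; lia.
case: v sv IH sv' {iv} => //= b v /andP[ba sb] IH sv'.
by have := IH 0%N sv' (ltn0Sn _); rewrite /=; lia.
Qed.

Section ShiftedSets.
Variables (N n K : nat).
Hypotheses (nN : (n <= N)%N) (nK : (n + N < K)%N).

Let K0 : (0 < K)%N. Proof. by apply: leq_ltn_trans nK. Qed.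

Lemma shifted_ltK la i : la \in intparts n -> (shifted la N i < K)%N.
Proof.
rewrite mem_intparts => /eqP sn; apply: leq_ltn_trans nK; rewrite leq_add //.
  by rewrite -sn nth_psize.
exact: leq_subr.
Qed.

Definition shifted_fun (la : intpart) : {ffun 'I_N -> 'I_K} :=
  [ffun i : 'I_N => insubd (Ordinal K0) (shifted la N i)].

Definition shifted_set (la : intpart) : {set 'I_K} :=
  (shifted_fun la @: [set: 'I_N])%SET.

Lemma shifted_funE la i : la \in intparts n -> shifted_fun la i = shifted la N i :> nat.
Proof.
by move=> lan; rewrite ffunE val_insubd shifted_ltK.
Qed.

Lemma shifted_sorted la : sorted gtn (mkseq (shifted la N) N).
Proof.
apply/(sortedP 0%N) => i; rewrite size_mkseq => iN.
rewrite !nth_mkseq //; last exact: ltnW.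
by apply: shifted_ltn; rewrite ltnSn.
Qed.

Lemma shifted_fun_inj la : la \in intparts n -> injective (shifted_fun la).
Proof.
move=> lan i j /(congr1 val) /=; rewrite !shifted_funE // => e; apply: val_inj => /=.
have [ij|ij|//] := ltngtP i j.
  have : (i < j < N)%N by rewrite ij ltn_ord.
  by move=> /(shifted_ltn la); rewrite e ltnn.
have : (j < i < N)%N by rewrite ij ltn_ord.
by move=> /(shifted_ltn la); rewrite e ltnn.
Qed.

Lemma mem_shifted_set la (x : 'I_K) : la \in intparts n ->
  (x \in shifted_set la) = (val x \in mkseq (shifted la N) N).
Proof.
move=> lan; apply/imsetP/mapP => [[i _ ->]|[i]].
  by exists (val i); [rewrite mem_iota ltn_ord | exact: shifted_funE].
rewrite mem_iota => iN xi; exists (Ordinal (iN : (i < N)%N)) => //.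
by apply: val_inj; rewrite [LHS]xi; apply/esym; exact: shifted_funE.
Qed.

Lemma shifted_set_inj : {in intparts n &, injective shifted_set}.
Proof.
move=> la mu lan mun e.
have eqs : mkseq (shifted la N) N = mkseq (shifted mu N) N.
  apply: (irr_sorted_eq gtn_trans ltnn) => [||x]; rewrite ?shifted_sorted //.
  have [xK|Kx] := ltnP x K.
    by rewrite -(mem_shifted_set (Ordinal xK) lan) e (mem_shifted_set (Ordinal xK) mun).
  have notin (nu : intpart) : nu \in intparts n -> (x \in mkseq (shifted nu N) N) = false.
    by move=> nun; apply/mapP => -[i _ xi]; move: Kx; rewrite xi leqNgt shifted_ltK.
  by rewrite !notin.
apply: intpart_eq => i; have [iN|iN] := ltnP i N.
  have := congr1 (nth 0%N ^~ i) eqs; rewrite !nth_mkseq // /shifted; lia.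
move: lan mun; rewrite !mem_intparts => /eqP sla /eqP smu.
by rewrite !nth_default //; apply: leq_trans iN; apply: leq_trans nN; 
   [rewrite -smu|rewrite -sla]; exact: size_psize.
Qed.

Lemma shifted_sum la : la \in intparts n ->
  (\sum_i shifted_fun la i)%N = (n + 'C(N, 2))%N.
Proof.
move=> lan; rewrite (eq_bigr (fun i : 'I_N => nth 0%N la i + (N - i.+1))%N); last first.
  by move=> i _; rewrite shifted_funE.
rewrite big_split /= -psize_nth; last first.
  move: lan; rewrite mem_intparts => /eqP sla; apply: leq_trans nN.
  by rewrite -sla size_psize.
move: lan; rewrite mem_intparts => /eqP ->; congr (_ + _)%N.
rewrite -bin2_sum big_mkord [RHS](reindex_inj rev_ord_inj) /=.
by apply: eq_bigr.
Qed.

(** Sorting the values of f and subtracting the staircase gives the parts. *)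
Lemma shifted_set_surj (f : {ffun 'I_N -> 'I_K}) : injective f ->
  (\sum_i f i)%N = (n + 'C(N, 2))%N ->
  exists2 la, la \in intparts n & (f @: [set: 'I_N])%SET = shifted_set la.
Proof.
move=> injf sf; pose v0 := [seq val (f i) | i <- enum 'I_N].
pose v := sort geq v0.
have pv : perm_eq v v0 by rewrite perm_sort.
have uv0 : uniq v0 by rewrite map_inj_uniq ?enum_uniq // => i j /val_inj /injf.
have uv : uniq v by rewrite (perm_uniq pv).
have szv : size v = N by rewrite (perm_size pv) size_map size_enum_ord.
have sv : sorted gtn v.
  have : sorted geq v by apply: sort_sorted => x y; exact: leq_total.
  move=> /(sortedP 0%N) sg; apply/(sortedP 0%N) => i iv.
  rewrite /= ltn_neqAle; apply/andP; split; last exact: (sg i iv).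
  by rewrite nth_uniq // ?(ltnW iv) // gtn_eqF.
pose w := mkseq (fun i => nth 0%N v i - (N - i.+1))%N N.
have sw : sorted geq w.
  apply/(sortedP 0%N) => i; rewrite size_mkseq => iN; rewrite !nth_mkseq //; last exact: ltnW.
  have := sv => /(sortedP 0%N) /(_ i); rewrite szv => /(_ iN) /=.
  by have := staircase_leq sv (i := i.+1); rewrite szv => /(_ iN); lia.
pose la := mkpart w.
have shE i : (i < N)%N -> shifted la N i = nth 0%N v i.
  move=> iN; rewrite /shifted nth_mkpart // nth_mkseq // subnK //.
  by have := staircase_leq sv (i := i); rewrite szv => /(_ iN).
have laN : (size la <= N)%N.
  rewrite leqNgt; apply/negP => Nla; have := intpart_pos la.
  rewrite -(_ : nth 0%N la N = 0%N) ?mem_nth //.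
  by rewrite nth_mkpart // nth_default // size_mkseq.
have lan : la \in intparts n.
  rewrite mem_intparts -(eqn_add2r 'C(N, 2)) -sf (psize_nth laN).
  rewrite -bin2_sum big_mkord [X in (_ + X)%N](reindex_inj rev_ord_inj) /= -big_split /=.
  rewrite (eq_bigr (fun i : 'I_N => nth 0%N v i)); last by move=> i _; rewrite -shE.
  have -> : (\sum_(i < N) nth 0%N v i = \sum_(x <- v) x)%N.
    by rewrite (big_nth 0%N) szv big_mkord.
  by rewrite (perm_big _ pv) /v0 big_map big_enum.
exists la => //; apply/setP => x; rewrite mem_shifted_set //.
have -> : mkseq (shifted la N) N = v.
  apply: (@eq_from_nth _ 0%N); rewrite size_mkseq ?szv // => i iN.
  by rewrite nth_mkseq // shE.
rewrite (perm_mem pv); apply/imsetP/mapP => [[i _ ->]|[i _ /val_inj ->]].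
  by exists i; rewrite ?mem_enum.
by exists i.
Qed.

End ShiftedSets.

(** * The generating series of one partition *)

Section OnePartition.
Variables (R : realType) (q : R).
Hypothesis q1 : 1 < q.

Let spec N (i : 'I_N) : R := q ^- i.+1.

Lemma altdet_staircase_neq0 N : altdet (@spec N) (fun i => shifted empty_intpart N i) != 0.
Proof.
rewrite altdet_geom // => [|i k ik]; last exact/ltnW/shifted_ltn.
have q0 : 0 < q by apply: lt_trans q1.
rewrite gt_eqF //; apply: prodr_gt0 => i _; rewrite mulr_gt0 ?invr_gt0 ?exprn_gt0 //.
apply: prodr_gt0 => j ij; apply: expr_gt1 => //.
have : (i < j < N)%N by rewrite ij ltn_ord.
by move=> /(shifted_ltn empty_intpart); lia.
Qed.

(** The Cauchy identity with x = y.  The hypothesis n <= N ensures that every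
    partition of n has at most N parts. *)
Lemma schur_fin_newton N : exists2 H,
  newton (fun m => (\sum_(i < N) (q ^- i.+1) ^+ m) ^+ 2) H &
  forall n, (n <= N)%N -> \sum_(la <- intparts n) schur_fin q la N ^+ 2 = H n.
Proof.
(* Truncation beyond all exponents and degrees in play when n <= N. *)
pose K := (N + N + 'C(N, 2)).+1.
have [|c [H [HN HE]]] := cauchy_identity (K := K) (@spec N) (@spec N) => //.
have HN' : newton (fun m => (\sum_(i < N) (q ^- i.+1) ^+ m) ^+ 2) H.
  by under eq_fun do rewrite expr2.
exists H => // n nN.
pose D := altdet (@spec N) (fun i => shifted empty_intpart N i) ^+ 2.
have D0 : D != 0 by rewrite sqrf_eq0; exact: altdet_staircase_neq0.
have key m : (m <= N)%N -> D * \sum_(la <- intparts m) schur_fin q la N ^+ 2 = c * H m.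
  move=> mN; have mK : (m + N < K)%N by rewrite /K; lia.
  rewrite -HE; last by rewrite /K; lia.
  pose S := shifted_set mK.
  have uS : uniq (map S (intparts m)).
    rewrite map_inj_in_uniq ?intparts_uniq //; exact: shifted_set_inj.
  rewrite (bigID (mem (map S (intparts m)))) /= [X in _ + X]big1 ?addr0 => [|T nT].
    rewrite -big_uniq //= big_map mulr_sumr; apply: eq_big_seq => la lam.
    rewrite /S /shifted_set altweight_image; last exact: shifted_fun_inj.
    rewrite shifted_sum // eqxx -expr2.
    have -> : altdet (@spec N) (fun i => shifted_fun mK la i) =
              altdet (@spec N) (fun i => shifted la N i).
      by congr (\det _); apply/matrixP => i j; rewrite !mxE shifted_funE.
    rewrite altdet_shifted ?exprMn //; apply: leq_trans mN.
    by move: lam; rewrite mem_intparts => /eqP <-; exact: size_psize.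
  apply: contraNeq nT => nz; have [f injf fS] := altweight_neq0 nz.
  move: nz; rewrite fS altweight_image //; case: ifPn => [/eqP sf _|]; last by rewrite eqxx.
  have [la lam ->] := shifted_set_surj mN mK injf (esym sf).
  exact: map_f.
(* The case n = 0 identifies the constant with the squared denominator. *)
have cD : c = D.
  have := key 0%N (leq0n N); rewrite HN'.1 mulr1 => <-.
  have -> : intparts 0 = [:: empty_intpart].
    apply: perm_small_eq => //; apply: uniq_perm => [||la]; rewrite ?intparts_uniq //.
    rewrite mem_intparts inE; apply/eqP/eqP => [la0|->//].
    by apply: val_inj; apply/eqP; rewrite -size_eq0 -leqn0 -[X in (_ <= X)%N]la0 size_psize.
  rewrite big_seq1 /schur_fin big_ord0 /hookprod /boxprod big_geq //.
  by rewrite invr1 mulr1 expr1n mulr1.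
by apply: (mulfI D0); rewrite key // cD.
Qed.

Definition pweight (la : intpart) : R :=
  q ^+ (2 * nstat (pconj la) + psize la) / hookprod q la ^+ 2.

Definition pweight_sum (n : nat) : R := \sum_(la <- intparts n) pweight la.

Lemma cvg_geom_powers m : (0 < m)%N ->
  (\sum_(i < N) (q ^- i.+1) ^+ m) @[N --> \oo] --> q ^- m / (1 - q ^- m).
Proof.
move=> m0; have q0 : 0 < q by apply: lt_trans q1.
have x1 : q ^- m < 1 by rewrite invf_lt1 ?exprn_gt0 // exprn_egt1 // -lt0n.
have x0 : 0 < q ^- m by rewrite invr_gt0 exprn_gt0.
have -> : (fun N => \sum_(i < N) (q ^- i.+1) ^+ m) =
          series (geometric (q ^- m) (q ^- m)).
  apply/funext => N; rewrite /series /= big_mkord; apply: eq_bigr => i _.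
  by rewrite /geometric /= -!exprVn -!exprM -exprD mulSn mulnC.
by apply: cvg_geometric_series; rewrite gtr0_norm.
Qed.

(** For each n the recurrence of the N-variable sums involves finitely many terms, so
    it survives the limit; the power sums of q^-1, ..., q^-N tend to
    q^-m / (1 - q^-m). *)
Theorem pweight_sum_newton :
  newton (fun m => q ^- m / (1 - q ^- m) ^+ 2) pweight_sum.
Proof.
have q0 : 0 < q by apply: lt_trans q1.
pose s n := \sum_(la <- intparts n) (q ^+ nstat (pconj la) / hookprod q la) ^+ 2.
have sE : pweight_sum = (fun n => q ^+ n * s n).
  apply/funext => n; rewrite /pweight_sum /s mulr_sumr; apply: eq_big_seq => la.
  rewrite mem_intparts => /eqP <-; rewrite /pweight exprMn exprVn -exprM exprD.
  by rewrite mulnC; ring.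
have cvs n : (\sum_(la <- intparts n) schur_fin q la N ^+ 2) @[N --> \oo] --> s n.
  apply: cvg_sum_seq => la; under eq_fun do rewrite expr2.
  by rewrite expr2; apply: cvgM; exact: cvg_schur_fin.
have rec n N : (\sum_(la <- intparts 0) schur_fin q la N ^+ 2 = 1) /\
    n.+1%:R * (\sum_(la <- intparts n.+1) schur_fin q la (N + n.+1) ^+ 2) =
    \sum_(i < n.+1) (\sum_(j < N + n.+1) (q ^- j.+1) ^+ i.+1) ^+ 2 *
      (\sum_(la <- intparts (n - i)) schur_fin q la (N + n.+1) ^+ 2).
  split; first by have [H [H0 _] ->] := schur_fin_newton N.
  have [H [_ HN] HE] := schur_fin_newton (N + n.+1).
  rewrite HE ?leq_addl // -[LHS]/(nderiv H n) HN; apply: eq_bigr => i _ /=.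
  by rewrite HE //; lia.
have sN : newton (fun m => (q ^- m / (1 - q ^- m)) ^+ 2) s.
  split.
    rewrite -(cvg_lim (@Rhausdorff R) (cvs 0%N)).
    under eq_fun do rewrite (rec 0%N _).1.
    exact: lim_cst.
  move=> n.
  pose l N := n.+1%:R * (\sum_(la <- intparts n.+1) schur_fin q la N ^+ 2).
  pose r N := \sum_(i < n.+1) (\sum_(j < N) (q ^- j.+1) ^+ i.+1) ^+ 2 *
      (\sum_(la <- intparts (n - i)) schur_fin q la N ^+ 2).
  have cl : l N @[N --> \oo] --> nderiv s n by apply: cvgM => //; exact: cvg_cst.
  have cr : r N @[N --> \oo] --> conv ((fun m => (q ^- m / (1 - q ^- m)) ^+ 2) \o succn) s n.
    apply: cvg_sum_seq => i; apply: cvgM => //.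
    by under eq_fun do rewrite expr2; rewrite /= expr2; apply: cvgM; exact: cvg_geom_powers.
  move: cl cr; rewrite -(cvg_shiftn n.+1 l) -(cvg_shiftn n.+1 r) => cl cr.
  rewrite -(cvg_lim (@Rhausdorff R) cl) -(cvg_lim (@Rhausdorff R) cr).
  by congr (lim (_ @ \oo)); apply/funext => N; exact: (rec n N).2.
rewrite sE; have := newton_scale q sN.
congr newton; apply/funext => -[|m].
  by rewrite expr0 invr1 subrr !expr2 !(mulr0, invr0).
rewrite expr_div_n [X in _ * (X / _)]expr2 !mulrA divff ?mul1r //.
by rewrite expf_neq0 // gt_eqF.
Qed.

End OnePartition.

(** * Collections of partitions *)

Section Collections.
Variables (F : finFieldType) (R : comNzRingType).
Variables (w : Phi F -> intpart -> R) (E : Phi F -> pred intpart).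
Implicit Types (La : collection F) (s : seq (Phi F)).

Definition part_series (phi : Phi F) (k : nat) : R :=
  \sum_(la <- intparts k | E phi la) w phi la.

Definition conv_series s : nat -> R :=
  foldr (fun phi a => conv (dilate (deg phi) (part_series phi)) a)
    (fun n => (n == 0%N)%:R) s.

Definition coll_in s n La : Prop :=
  [/\ forall phi, phi \notin s -> La phi = empty_intpart,
      forall phi, phi \in s -> E phi (La phi) &
      (\sum_(phi <- s) psize (La phi) * deg phi = n)%N].

Lemma deg_gt0 (phi : Phi F) : (0 < deg phi)%N.
Proof. by have /and3P[_ ip _] := valP phi; exact: irr_deg_gt0. Qed.

Definition set_part (phi : Phi F) La (la : intpart) : collection F :=
  [fsfun La with phi |-> la].

Lemma set_partE phi La la psi :
  set_part phi La la psi = if psi == phi then la else La psi.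
Proof. exact: fsfun_withE. Qed.

(** A collection supported in phi :: s is a partition at phi together with a
    collection supported in s, and sizes add up: the sum is a convolution. *)
Lemma coll_inP s n : uniq s -> exists L : seq (collection F),
  [/\ uniq L, forall La, La \in L <-> coll_in s n La &
      \sum_(La <- L) \prod_(phi <- s) w phi (La phi) = conv_series s n].
Proof.
elim: s n => [|phi s IH] n.
  move=> _; pose La0 : collection F := [fsfun].
  exists (if n == 0%N then [:: La0] else [::]); split.
  - by case: ifP.
  - move=> La; case: eqP => n0; last by split=> // -[_ _]; rewrite big_nil => /esym.
    rewrite inE; split=> [/eqP ->|[h _ _]].
      by split=> // [psi _|]; rewrite ?fsfun0E // big_nil n0.
    by apply/eqP/fsfunP => psi; rewrite fsfun0E h.
  - by rewrite /=; case: eqP => _; rewrite ?big_seq1 ?big_nil.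
move=> /= /andP[phis us].
have [Ls Ls_spec] := choice (fun m => IH m us).
pose d := deg phi; have d0 : (0 < d)%N := deg_gt0 phi.
pose I := undup [seq la <- flatten (map intparts (iota 0 n.+1)) |
  E phi la && (d * psize la <= n)%N].
have memI la : (la \in I) = E phi la && (d * psize la <= n)%N.
  rewrite mem_undup mem_filter andb_idr // => /andP[_ dn].
  apply/flattenP; exists (intparts (psize la)); last by rewrite mem_intparts.
  by apply: map_f; rewrite mem_iota /= add0n ltnS (leq_trans _ dn) // leq_pmull.
exists [seq set_part phi La la | la <- I, La <- Ls (n - d * psize la)%N]; split.
- apply: allpairs_uniq_dep; first exact: undup_uniq.
    by move=> la _; have [] := Ls_spec (n - d * psize la)%N.
  move=> _ _ /allpairsPdep[la [La [laI Lal ->]]] /allpairsPdep[mu [Mu [muI Mul ->]]] /=.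
  move=> e; have elm : la = mu.
    by have /fsfunP/(_ phi) := e; rewrite !set_partE eqxx.
  move: mu elm muI Mul e => _ <- _ Mul e; congr (Tagged _ _).
  have [_ /(_ La)[/(_ Lal) [La0 _ _] _] _] := Ls_spec (n - d * psize la)%N.
  have [_ /(_ Mu)[/(_ Mul) [Mu0 _ _] _] _] := Ls_spec (n - d * psize la)%N.
  apply/fsfunP => psi; have /fsfunP/(_ psi) := e; rewrite !set_partE.
  by case: eqP => [->|//] _; rewrite La0 ?Mu0.
- have sum_set La la : (\sum_(psi <- s) psize (set_part phi La la psi) * deg psi =
                        \sum_(psi <- s) psize (La psi) * deg psi)%N.
    apply: eq_big_seq => psi psis; rewrite set_partE ifF //.
    by apply/negP => /eqP e; case/negP: phis; rewrite -e.
  move=> La; split=> [/allpairsPdep[la [Mu [laI Mul ->]]]|[La0 LaE sLa]].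
    have [_ /(_ Mu)[/(_ Mul) [Mu0 MuE sMu] _] _] := Ls_spec (n - d * psize la)%N.
    move: laI; rewrite memI => /andP[Ela dla].
    split=> [psi|psi|].
    + by rewrite inE negb_or set_partE => /andP[/negbTE -> /Mu0].
    + by rewrite inE set_partE; case: eqP => [-> //|_ /= /MuE].
    + by rewrite big_cons sum_set sMu set_partE eqxx mulnC subnKC.
  have phiIn : (d * psize (La phi) <= n)%N by rewrite -sLa big_cons mulnC leq_addr.
  pose Mu := set_part phi La empty_intpart.
  apply/allpairsPdep; exists (La phi), Mu; split.
  + by rewrite memI phiIn LaE ?mem_head.
  + have [_ /(_ Mu)[_] h _] := Ls_spec (n - d * psize (La phi))%N; apply: h.
    split=> [psi psis|psi psis|].
    * by rewrite set_partE; case: eqP => // /eqP e; rewrite La0 // inE negb_or e.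
    * rewrite set_partE ifF ?LaE ?inE ?psis ?orbT //.
      by apply/negP => /eqP e; case/negP: phis; rewrite -e.
    * by rewrite sum_set -sLa big_cons mulnC addKn.
  + by apply/fsfunP => psi; rewrite !set_partE; case: eqP => [->|].
rewrite big_allpairs_dep /=.
transitivity (\sum_(la <- I) w phi la * conv_series s (n - d * psize la)%N).
  apply: eq_bigr => la _; have [_ _ <-] := Ls_spec (n - d * psize la)%N.
  rewrite mulr_sumr; apply: eq_bigr => La _; rewrite big_cons set_partE eqxx.
  congr (_ * _); apply: eq_big_seq => psi psis; rewrite set_partE ifF //.
  by apply/negP => /eqP e; case/negP: phis; rewrite -e.
rewrite big_seq_cond (partition_big (fun la => inord (d * psize la)%N : 'I_n.+1) xpredT) //=.
apply: eq_bigr => j _; rewrite -big_filter.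
have jn : (j <= n)%N by rewrite -ltnS.
pose J := if (d %| j)%N then [seq la <- intparts (j %/ d) | E phi la] else [::].
rewrite (perm_big J) /=; last first.
  apply: uniq_perm; first by rewrite filter_uniq // undup_uniq.
    by rewrite /J; case: ifP => // _; rewrite filter_uniq // intparts_uniq.
  move=> la; rewrite mem_filter andbT memI /J andbC.
  have [Ela|nEla] := boolP (E phi la); last first.
    by case: ifP => _; rewrite ?andbF //= mem_filter (negbTE nEla) //= andbF.
  have -> : la \in (if (d %| j)%N then [seq mu <- intparts (j %/ d) | E phi mu] else [::]) =
    (d * psize la == j)%N.
    case: ifP => [/dvdnP[k ->]|dj].
      by rewrite mem_filter Ela mem_intparts mulnK // mulnC eqn_pmul2r.
    by rewrite in_nil; apply/esym/eqP => e; rewrite -e dvdn_mulr in dj.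
  have [le|lt] /= := leqP (d * psize la) n; last by apply/esym/gtn_eqF; exact: leq_ltn_trans lt.
  by rewrite -val_eqE /= inordK.
rewrite /J /dilate -/d; case: ifP => [/dvdnP[k jk]|_]; last by rewrite big_nil mul0r.
rewrite big_filter /part_series mulr_suml big_seq_cond [RHS]big_seq_cond.
apply: eq_bigr => la /andP[]; rewrite mem_intparts jk mulnK // => /eqP -> _.
by rewrite mulnC.
Qed.

End Collections.

(** * Removing finitely many factors *)

Section LinearFactors.
Variable R : realType.

(** Multiplication by (1 - z u^d)^e multiplies the limit by (1 - z)^e, since
    (1 - z u^d) A has coefficients a_n - z a_(n-d). *)
Lemma newton_mul_linear p (a : nat -> R) l (d : nat) (z : R) (e : nat) : (0 < d)%N ->
  newton p a -> a n @[n --> \oo] --> l ->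
  exists2 b, newton (fun m => p m - (e * d)%:R * dilate d (fun i => z ^+ i) m) b &
    b n @[n --> \oo] --> (1 - z) ^+ e * l.
Proof.
move=> d0; elim: e p a l => [|e IH] p a l aN al.
  exists a; last by rewrite expr0 mul1r.
  by congr newton: aN; apply/funext => m; rewrite mul0n mul0r subr0.
pose lin n : R := if n is n'.+1 then if n' is 0%N then - z else 0 else 1.
have bN := newton_conv (newton_dilate d0 (newton_linear z)) aN.
have bl : conv (dilate d lin) a n @[n --> \oo] --> (1 - z) * l.
  have E n : conv (dilate d lin) a (n + d)%N = a (n + d)%N - z * a n.
    rewrite /conv big_ord_recl /= subn0 {1}/dilate dvdn0 div0n mul1r; congr (_ + _).
    have dn : (d.-1 < n + d)%N by lia.
    rewrite (bigD1 (Ordinal dn)) //= big1 ?addr0 => [|i ni].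
      by rewrite /bump /= add1n prednK // /dilate dvdnn divnn d0 addnK mulNr.
    rewrite /dilate /bump /= add1n; case: ifP => [/dvdnP[k ik]|]; last by rewrite mul0r.
    rewrite ik mulnK //; case: k ik => [|[|k]] ik //; last by rewrite mul0r.
    case/eqP: ni; apply: val_inj => /=; lia.
  rewrite -(cvg_shiftn d); under eq_fun do rewrite E.
  rewrite mulrBl mul1r; apply: cvgB; first by rewrite (cvg_shiftn d).
  by apply: cvgM => //; exact: cvg_cst.
have [b bN' bl'] := IH _ _ _ bN bl; exists b; last by rewrite exprSr -mulrA.
congr newton: bN'; apply/funext => m /=; rewrite /dilate mulSn natrD.
by case: ifP => _; ring.
Qed.

Lemma newton_mul_linears (T : Type) (r : seq T) p (a : nat -> R) l
    (d e : T -> nat) (z : T -> R) : (forall t, (0 < d t)%N) ->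
  newton p a -> a n @[n --> \oo] --> l ->
  exists2 b, newton (fun m => p m -
      \sum_(t <- r) (e t * d t)%:R * dilate (d t) (fun i => z t ^+ i) m) b &
    b n @[n --> \oo] --> (\prod_(t <- r) (1 - z t) ^+ e t) * l.
Proof.
move=> d0 aN al; elim: r => [|t r [b bN bl]].
  exists a; last by rewrite big_nil mul1r.
  by congr newton: aN; apply/funext => m; rewrite big_nil subr0.
have [c cN cl] := newton_mul_linear (z t) (e t) (d0 t) bN bl.
exists c; last by rewrite big_cons -mulrA.
by congr newton: cN; apply/funext => m; rewrite big_cons opprD addrA addrAC.
Qed.

(** Small logarithmic derivative means series close to 1.  The bound reproduces
    itself: the n + 1 terms of the recurrence are each at most eps y^(n+1). *)
Lemma newton_small (e b : nat -> R) (eps y : R) : newton e b ->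
  0 <= eps <= 1 -> 0 <= y -> (forall m, (0 < m)%N -> `|e m| <= eps * y ^+ m) ->
  forall n, (0 < n)%N -> `|b n| <= eps * y ^+ n.
Proof.
move=> [b0 Db] /andP[e0 e1] y0 eb; elim/ltn_ind => -[//|n] IH _.
have n0 : 0 < n.+1%:R :> R by rewrite ltr0n.
rewrite -(ler_pM2l n0) -[X in X * `|_|](ger0_norm (ltW n0)) -normrM.
rewrite -[_ * b n.+1]/(nderiv b n) Db /conv.
apply: le_trans (ler_norm_sum _ _ _) _.
rewrite mulr_natl -[X in _ *+ X](card_ord n.+1) -sumr_const; apply: ler_sum => i _ /=.
rewrite normrM; have ni := ltn_ord i.
have [ni0|ni'] := eqVneq (n - i)%N 0%N.
  have -> : y ^+ n.+1 = y ^+ i.+1 by congr (_ ^+ _); lia.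
  by rewrite ni0 b0 normr1 mulr1 eb.
have hb : `|b (n - i)%N| <= y ^+ (n - i).
  apply: le_trans (IH _ _ _) _; [lia|lia|].
  by rewrite ler_piMl ?exprn_ge0.
have -> : y ^+ n.+1 = y ^+ i.+1 * y ^+ (n - i) by rewrite -exprD; congr (_ ^+ _); lia.
by rewrite mulrA; apply: ler_pM => //; exact: eb.
Qed.

End LinearFactors.

Section Asymptotics.
Variables (R : realType) (q : R).
Hypothesis q2 : 2 <= q.

Let q0 : 0 < q. Proof. by have := q2; lra. Qed.
Let q1 : 1 < q. Proof. by have := q2; lra. Qed.

Definition euler_prod (n : nat) : R := \prod_(1 <= i < n.+1) (1 - q ^- i).

Lemma qexp_le_half i : q ^- i <= 2 ^- i.
Proof. by rewrite lef_pV2 ?posrE ?exprn_gt0 // lerXn2r ?nnegrE // ltW. Qed.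

Lemma qexp_gt0 i : 0 < q ^- i.
Proof. by rewrite invr_gt0 exprn_gt0. Qed.

Lemma qexp_lt1 i : (0 < i)%N -> q ^- i < 1.
Proof. by move=> i0; rewrite invf_lt1 ?exprn_gt0 // exprn_egt1 // -lt0n. Qed.

(** For q = 2 the product of the 1 - 2^-i stays above 1/4; the extra term makes the
    induction work, and larger q only increase the factors. *)
Lemma euler_prod_ge n : 4^-1 + 2 ^- n.+2 <= euler_prod n.+1.
Proof.
elim: n => [|n IH].
  rewrite /euler_prod big_nat1; have := qexp_le_half 1; rewrite expr1 !exprS expr0.
  by lra.
rewrite /euler_prod big_nat_recr //= -/(euler_prod n.+1).
have h := qexp_le_half n.+2.
have h2 : 2 ^- n.+2 <= 4^-1 :> R.
  have -> : 4^-1 = 2 ^- 2 :> R by rewrite -natrX.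
  by rewrite lef_pV2 ?posrE ?exprn_gt0 // ler_eXn2l // ltr1n.
have h3 : 2 ^- n.+3 = 2 ^- n.+2 / 2 :> R by rewrite exprSr invfM.
have h0 : 0 < 2 ^- n.+2 :> R by rewrite invr_gt0 exprn_gt0.
have qn := qexp_gt0 n.+2.
rewrite h3; set t := 2 ^- n.+2 in IH h h2 h0 *.
apply: (@le_trans _ _ ((4^-1 + t) * (1 - t))); first by nra.
by apply: ler_pM => //; lra.
Qed.

Lemma euler_prod_gt0 n : 0 < euler_prod n.
Proof.
rewrite /euler_prod big_nat; apply: prodr_gt0 => i /andP[i0 _].
by rewrite subr_gt0 qexp_lt1.
Qed.

Lemma euler_prodS n : euler_prod n.+1 = euler_prod n * (1 - q ^- n.+1).
Proof. by rewrite /euler_prod big_nat_recr. Qed.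

Lemma cvg_euler_prod : exists2 l : R, 0 < l & euler_prod n @[n --> \oo] --> l.
Proof.
have dec : nonincreasing_seq euler_prod.
  apply/nonincreasing_seqP => n; rewrite euler_prodS ler_piMr ?(ltW (euler_prod_gt0 n)) //.
  by rewrite gerBl ltW ?qexp_gt0.
have lb n : 4^-1 <= euler_prod n.
  apply: (le_trans _ (dec n n.+1 (leqnSn n))); apply: le_trans (euler_prod_ge n).
  by rewrite lerDl invr_ge0 exprn_ge0.
have cv : cvgn euler_prod.
  by apply: nonincreasing_is_cvgn => //; exists 4^-1 => _ [n _ <-].
exists (limn euler_prod) => //.
apply: (@lt_le_trans _ _ (4^-1 : R)); first by rewrite invr_gt0.
by apply: limr_ge => //; apply: nearW.
Qed.

(** Let A be the series with these p_m.  Both (1 - u) A(u) and A(u / q) have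
    p_m = q^-m / (1 - q^-m), so they are equal, and comparing coefficients gives
    a_n = a_(n-1) / (1 - q^-n). *)
Lemma newton_euler_inv :
  newton (fun m => (1 - q ^- m)^-1) (fun n => (euler_prod n)^-1).
Proof.
have [a aN] := newton_exists (fun m => (1 - q ^- m)^-1).
suff -> : (fun n => (euler_prod n)^-1) = a by [].
(* lin is the series 1 - u. *)
pose lin n : R := if n is n'.+1 then if n' is 0%N then - 1 else 0 else 1.
have e n : conv lin a n = q^-1 ^+ n * a n.
  apply: newton_eq (newton_conv (newton_linear 1) aN) (newton_scale q^-1 aN) _.
  move=> i /andP[i0 _] /=; rewrite expr1n exprVn.
  have : 1 - q ^- i != 0 by rewrite subr_eq0 gt_eqF // qexp_lt1.
  by move: (q ^- i) => x h; field.
have rec n : a n.+1 - a n = q ^- n.+1 * a n.+1.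
  rewrite -exprVn -e /conv !big_ord_recl /= subn0 mul1r big1 => [|i _].
    by rewrite addr0 /bump /= subSS subn0 mulN1r.
  by rewrite mul0r.
apply/funext; elim=> [|n IH]; first by rewrite /euler_prod big_geq // invr1 aN.1.
have h : 1 - q ^- n.+1 != 0 by rewrite subr_eq0 gt_eqF // qexp_lt1.
rewrite euler_prodS invfM IH; apply: (mulIf h); rewrite mulfVK //.
by have := rec n; rewrite mulrBr mulr1 [a n.+1 * _]mulrC => <-; ring.
Qed.

End Asymptotics.

(** The left-hand side is sum_(r > N) r x^r when |x| < 1. *)
Lemma linear_geom_tail (R : fieldType) (x : R) N : x != 1 ->
  x / (1 - x) ^+ 2 - \sum_(1 <= r < N.+1) r%:R * x ^+ r =
  x ^+ N.+1 * (N.+1%:R - N%:R * x) / (1 - x) ^+ 2.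
Proof.
move=> x1; have h : 1 - x != 0 by rewrite subr_eq0 eq_sym.
elim: N => [|N IH]; first by rewrite big_geq // mul0r !subr0 mulr1 expr1.
rewrite big_nat_recr //= opprD addrA IH !exprS -[N.+2%:R]natr1 -[N.+1%:R]natr1.
by move: (x ^+ N) => y; field.
Qed.

Lemma cvg_linear_half (R : realType) (c : R) :
  c * N.+1%:R * 2 ^- N @[N --> \oo] --> (0 : R).
Proof.
have b N : N.+1%:R <= 2 * (3 / 2) ^+ N :> R.
  elim: N => [|[|N] IH]; rewrite ?expr0 ?expr1; [lra| |].
    by lra.
  rewrite exprS -natr1 (_ : 2 * _ = 3 / 2 * (2 * (3 / 2) ^+ N.+1)); last by ring.
  apply: (@le_trans _ _ (3 / 2 * N.+2%:R)); last by rewrite ler_pM2l //; lra.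
  have : 2 <= N.+2%:R :> R by rewrite ler_nat.
  by lra.
have cg : `|c| * 2 * (3 / 4) ^+ N @[N --> \oo] --> (0 : R).
  rewrite -[X in _ --> X](mulr0 (`|c| * 2)); apply: cvgM; first exact: cvg_cst.
  by apply: cvg_expr; rewrite ger0_norm; lra.
apply: norm_cvg0; apply: (squeeze_cvgr _ (cvg_cst 0) cg); apply: nearW => N.
rewrite normr_ge0 /= !normrM -!mulrA; apply: ler_pM => //.
have -> : (3 / 4 : R) = 3 / 2 * 2^-1 by lra.
rewrite exprMn exprVn mulrA; rewrite !ger0_norm //.
by apply: ler_pM; rewrite ?b.
Qed.

(** Uniform approximation: the limits in n and N can be exchanged. *)
Lemma cvg_approx (R : realType) (x : nat -> R) (y : nat -> nat -> R)
    (l : nat -> R) (L : R) (eta : nat -> R) :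
  (forall N, y N n @[n --> \oo] --> l N) -> l N @[N --> \oo] --> L ->
  eta N @[N --> \oo] --> (0 : R) ->
  (\forall N \near \oo, forall n, `|y N n - x n| <= eta N) ->
  x n @[n --> \oo] --> L.
Proof.
move=> yl lL eta0 hyx; apply/cvgrPdist_le => e e0.
have e3 : 0 < e / 3 by rewrite divr_gt0.
have /cvgrPdist_le/(_ _ e3) h1 := lL.
have /cvgrPdist_le/(_ _ e3) h2 := eta0.
have [N [[N1 N2] N3]] : exists N, (`|L - l N| <= e / 3 /\ `|0 - eta N| <= e / 3) /\
    forall n, `|y N n - x n| <= eta N.
  apply: (@filter_ex _ \oo); near=> N; split; first split; near: N => //.
have /cvgrPdist_le/(_ _ e3) h3 := yl N.
near=> n.
have h3n : `|l N - y N n| <= e / 3 by near: n.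
have h4n := N3 n; move: N2; rewrite sub0r normrN => N2.
have h5 := le_trans h4n (ler_norm (eta N)).
have -> : L - x n = (L - l N) + (l N - y N n) + (y N n - x n) by ring.
apply: le_trans (ler_normD _ _) _; apply: le_trans (lerD (ler_normD _ _) (lexx _)) _.
by lra.
Unshelve. all: by end_near. Qed.

Section RemovedFactors.
Variables (R : realType) (q : R) (k : nat) (d : 'I_k -> nat) (A : nat -> R).
Hypothesis q2 : 2 <= q.
Hypothesis d0 : forall j, (0 < d j)%N.

(** The p_m of the product of the S_(q^deg phi)(u^deg phi) over all phi in Phi except
    k of them, of degrees d j. *)
Definition removed_powers (m : nat) : R :=
  (1 - q ^- m)^-1 - \sum_(j < k) (d j)%:R * dilate (d j)
     (fun i => (q ^+ d j) ^- i / (1 - (q ^+ d j) ^- i) ^+ 2) m.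

Hypothesis A_newton : newton removed_powers A.

Let tail (N m : nat) : R := \sum_(j < k) (d j)%:R * dilate (d j)
  (fun i => (q ^+ d j) ^- i / (1 - (q ^+ d j) ^- i) ^+ 2 -
            \sum_(1 <= r < N.+1) r%:R * (q ^+ d j) ^- i ^+ r) m.

Let eps (N : nat) : R := (4 * (\sum_j d j)%:R) * N.+1%:R * 2 ^- N.

(** With x = q^-m <= 2^-m <= 1/2, the tail of sum_r r x^r beyond N is at most
    (N + 1) x^(N+1) / (1 - x)^2 <= 4 (N + 1) 2^-N x. *)
Lemma tail_bound N m : (0 < m)%N -> `|tail N m| <= eps N * 2^-1 ^+ m.
Proof.
move=> m0; rewrite /tail /eps.
apply: le_trans (ler_norm_sum _ _ _) _.
rewrite -!mulrA mulrCA natr_sum mulr_suml; apply: ler_sum => j _.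
rewrite normrM normr_nat; apply: ler_wpM2l => //.
rewrite /dilate; case: ifP => [/dvdnP[i mi]|_]; last first.
  by rewrite normr0 !mulr_ge0 ?invr_ge0 ?exprn_ge0.
rewrite mi mulnK // -!exprVn -!exprM -mi [(d j * i)%N]mulnC -mi !exprVn.
have xh := qexp_le_half q2 m; have x0 := qexp_gt0 q2 m; have x1 := qexp_lt1 q2 m0.
have hh : 2 ^- m <= 2^-1 :> R.
  by rewrite lef_pV2 ?posrE ?exprn_gt0 // -[X in X <= _]expr1 ler_eXn2l // ltr1n.
have xx1 : q ^- m != 1 by rewrite lt_eqF.
have -> : \sum_(1 <= r < N.+1) r%:R * q ^- m ^+ r = \sum_(1 <= r < N.+1) r%:R * (q ^- m) ^+ r by [].
rewrite linear_geom_tail //.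
move: (q ^- m) xh x0 x1 xx1 => x xh x0 x1 xx1.
have xl : x <= 2^-1 by exact: le_trans xh hh.
have D0 : 0 < (1 - x) ^+ 2 by rewrite exprn_gt0 // subr_gt0.
have N0 : 0 <= N%:R :> R by [].
have NN : N.+1%:R = N%:R + 1 :> R by rewrite natr1.
have t0 : 0 <= N.+1%:R - N%:R * x by rewrite NN; nra.
rewrite ger0_norm; last by rewrite divr_ge0 ?(ltW D0) // mulr_ge0 // exprn_ge0 // ltW.
rewrite ler_pdivrMr // exprSr.
have xN : x ^+ N <= 2 ^- N.
  by rewrite -exprVn lerXn2r ?nnegrE ?invr_ge0 // ltW.
have D4 : 1 <= 4 * (1 - x) ^+ 2 by rewrite expr2; nra.
have tN : N.+1%:R - N%:R * x <= N.+1%:R by rewrite NN; nra.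
rewrite [leRHS](_ : _ = (2 ^- N * 2 ^- m) * (N.+1%:R * (4 * (1 - x) ^+ 2))); last by ring.
apply: ler_pM => //; first by rewrite mulr_ge0 ?exprn_ge0 // ltW.
  by apply: ler_pM => //; rewrite ?exprn_ge0 // ltW.
by apply: le_trans tN _; rewrite ler_peMr.
Qed.

(** Only the factors (1 - u^d q^(-r d))^r with r <= N are multiplied in; the missing
    ones appear as the tail. *)
Lemma approx_newton N l : euler_prod q n @[n --> \oo] --> l -> 0 < l ->
  exists2 b, newton (removed_powers \+ tail N) b &
    b n @[n --> \oo] --> (\prod_(j < k) Mfactor 1 (q ^+ d j) N) * l^-1.
Proof.
move=> el l0.
have al : (euler_prod q n)^-1 @[n --> \oo] --> l^-1 by apply: cvgV; rewrite ?gt_eqF.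
have [b bN bl] := newton_mul_linears [seq (j, r) | j <- enum 'I_k, r <- iota 1 N]
  (fun t : 'I_k * nat => t.2) (fun t : 'I_k * nat => (q ^+ d t.1) ^- t.2)
  (fun t : 'I_k * nat => d0 t.1) (newton_euler_inv q2) al.
exists b.
  congr newton: bN; apply/funext => m /=; rewrite /removed_powers /tail -addrA; congr (_ + _).
  rewrite big_allpairs_dep /= big_enum /= -!sumrN -big_split /=.
  apply: eq_bigr => j _; rewrite /index_iota subSS subn0 /dilate.
  case: ifP => [_|_]; last first.
    by rewrite !mulr0 oppr0 addr0 big1 ?oppr0 // => r _; rewrite mulr0.
  rewrite mulrBr addrA addNr add0r mulr_sumr; congr (- _); apply: eq_bigr => r _.
  have -> : (q ^+ d j) ^- r ^+ (m %/ d j) = (q ^+ d j) ^- (m %/ d j) ^+ r.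
    by rewrite -!exprVn -!exprM; congr (_ ^+ _); lia.
  by rewrite natrM mulrA [_%:R * r%:R]mulrC.
move: bl; set P1 := \prod_(t <- _) _; suff -> : P1 = \prod_(j < k) Mfactor 1 (q ^+ d j) N by [].
rewrite /P1 big_allpairs_dep /= big_enum /=; apply: eq_bigr => j _.
rewrite /Mfactor /index_iota subSS subn0; apply: eq_bigr => r _.
by rewrite mul1r.
Qed.

(** The sequence b N with finitely many factors is the convolution of A with a
    sequence that is close to 1 uniformly in n, and b N converges for each N. *)
Theorem cvg_removed l : euler_prod q n @[n --> \oo] --> l -> 0 < l ->
  A n @[n --> \oo] --> (\prod_(j < k) limn (Mfactor 1 (q ^+ d j))) * l^-1.
Proof.
move=> el l0.
have /choice[b hb] : forall N, exists b, newton (removed_powers \+ tail N) b /\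
    (b n @[n --> \oo] --> (\prod_(j < k) Mfactor 1 (q ^+ d j) N) * l^-1).
  by move=> N; have [b bN bl] := approx_newton N el l0; exists b.
have eps0 : eps N @[N --> \oo] --> (0 : R) by exact: cvg_linear_half.
have epsge0 N : 0 <= eps N by rewrite /eps !mulr_ge0 ?invr_ge0 ?exprn_ge0.
have /choice[r rN] : forall N, exists r, newton (tail N) r.
  by move=> N; exact: newton_exists.
have bE N n : b N n = conv (r N) A n.
  have [bN _] := hb N; apply: newton_eq bN (newton_conv (rN N) A_newton) _ => i _ /=.
  by rewrite addrC.
have rb N n : eps N <= 1 -> (0 < n)%N -> `|r N n| <= eps N * 2^-1 ^+ n.
  move=> e1; apply: (newton_small (rN N)) => //; first by rewrite epsge0.
  exact: tail_bound.
have diff N n (B : R) : eps N <= 1 -> 0 <= B -> (forall m, (m < n)%N -> `|A m| <= B) ->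
    `|b N n - A n| <= eps N * B.
  move=> e1 B0 hB; rewrite bE /conv big_ord_recl subn0 (rN N).1 mul1r addrAC subrr add0r.
  apply: le_trans (ler_norm_sum _ _ _) _.
  apply: (@le_trans _ _ (\sum_(i < n) eps N * B * 2^-1 ^+ i.+1)).
    apply: ler_sum => i _; have ni := ltn_ord i.
    rewrite normrM lift0 mulrAC; apply: ler_pM => //; first exact: rb.
    by apply: hB; lia.
  rewrite -mulr_sumr ler_piMr ?mulr_ge0 //.
  have -> : \sum_(i < n) 2^-1 ^+ i.+1 = 1 - 2^-1 ^+ n :> R.
    elim: (n) => [|m IH]; first by rewrite big_ord0 expr0 subrr.
    by rewrite big_ord_recr /= IH exprS; lra.
  by rewrite gerBl exprn_ge0.
have epsnear (c : R) : 0 < c -> \forall N \near \oo, eps N <= c.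
  move=> c0; have /cvgrPdist_le/(_ _ c0) := eps0; apply: filterS => N.
  by rewrite sub0r normrN; exact: le_trans (ler_norm _).
have [B B0 hB] : exists2 B, 0 <= B & forall n, `|A n| <= B.
  (* With eps N <= 1/2 the bound |A| <= 2 C reproduces itself:
     |A n| <= |b N n| + eps N * 2 C <= C + C. *)
  have [N eN] : exists N, eps N <= 2^-1 by apply: (@filter_ex _ \oo); exact: epsnear.
  have [_ bl] := hb N.
  have [M0 [_ hM]] : bounded_fun (b N) by apply: cvg_seq_bounded; apply/cvg_ex; exists (
    (\prod_(j < k) Mfactor 1 (q ^+ d j) N) * l^-1).
  pose C : R := `|M0| + 1; have C0 : 0 <= C by rewrite addr_ge0.
  have bC n : `|b N n| <= C.
    by apply: (hM C) => //; apply: (le_lt_trans (ler_norm M0)); rewrite ltrDl.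
  exists (2 * C) => [|n]; first by rewrite mulr_ge0.
  elim/ltn_ind: n => n IH; have e1 : eps N <= 1 by apply: le_trans eN _; lra.
  have h := diff N n (2 * C) e1 (mulr_ge0 (ler0n _ 2) C0) IH.
  have -> : A n = b N n - (b N n - A n) by ring.
  apply: le_trans (ler_normB _ _) _; apply: le_trans (lerD (bC n) h) _.
  by have := ler_wpM2r C0 eN; rewrite mulrCA; lra.
apply: (@cvg_approx _ A b (fun N => (\prod_(j < k) Mfactor 1 (q ^+ d j) N) * l^-1) _
  (fun N => eps N * B)).
- by move=> N; have [] := hb N.
- apply: cvgM; last exact: cvg_cst.
  apply: cvg_prod_seq => j; apply: is_cvg_Mfactor; last rewrite ltr01 /=.
    by rewrite exprn_egt1 ?(lt_le_trans _ q2) ?ltr1n // -lt0n.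
  by rewrite exprn_egt1 ?(lt_le_trans _ q2) ?ltr1n // -lt0n.
- by rewrite -[X in _ --> X](mul0r B); apply: cvgM => //; exact: cvg_cst.
by apply: filterS (epsnear 1 ltr01) => N e1 n; exact: diff.
Qed.

End RemovedFactors.

(** * Plancherel measure of a cylinder and its limit *)

Section Plancherel.
Variables (R : realType) (F : finFieldType).

Let q : R := #|F|%:R.

Lemma card_field_ge2 : 2 <= q.
Proof. by rewrite ler_nat; exact: card_finNzRing_gt1. Qed.

Let q0 : 0 < q. Proof. by have := card_field_ge2; lra. Qed.
Let q1 : 1 < q. Proof. by have := card_field_ge2; lra. Qed.

Lemma GLorderE n :
  GLorder F n = (#|F| ^ 'C(n, 2) * \prod_(1 <= i < n.+1) (#|F| ^ i - 1))%N.
Proof.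
case: n => [|n].
  rewrite big_geq // muln1 expn0 /GLorder; apply/eqP/cards1P; exists (0 : 'M[F]_0).
  by apply/setP => A; rewrite !inE [A]flatmx0 unitmxE det_mx00 unitr1 eqxx.
rewrite -card_GL // /GLorder cardsT card_sub cardsE.
by apply: eq_card => A; rewrite !inE.
Qed.

Definition weight (phi : Phi F) (la : intpart) : R := pweight (q ^+ deg phi) la.

Lemma pweight_ge0 (Q : R) la : 1 < Q -> 0 <= pweight Q la.
Proof.
move=> Q1; have Q0 : 0 < Q by exact: lt_trans Q1.
by apply: divr_ge0; [exact/exprn_ge0/ltW | exact: sqr_ge0].
Qed.

Lemma deg_exp_gt1 (phi : Phi F) : 1 < q ^+ deg phi.
Proof. by rewrite exprn_egt1 // -lt0n deg_gt0. Qed.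

Lemma boxprodV (la : intpart) (f g : nat -> nat -> R) :
  (forall i j, g i j = (f i j)^-1) -> boxprod la g = (boxprod la f)^-1.
Proof.
move=> gf; rewrite /boxprod -prodfV; apply: eq_bigr => i _.
by rewrite -prodfV; apply: eq_bigr => j _.
Qed.

(** Lets a product over the support of La run over any finite set of phi that contains
    it. *)
Lemma big_finsupp (T : Type) (idx : T) (op : Monoid.com_law idx) (La : collection F)
    (s : seq (Phi F)) (f : Phi F -> T) : uniq s ->
  (forall phi, phi \notin s -> La phi = empty_intpart) ->
  (forall phi, La phi = empty_intpart -> f phi = idx) ->
  \big[op/idx]_(phi <- finsupp La) f phi = \big[op/idx]_(phi <- s) f phi.
Proof.
move=> us La0 f1; rewrite [RHS](bigID (mem (finsupp La))) /= [X in op _ X]big1.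
  rewrite Monoid.mulm1 -[RHS]big_filter; apply/perm_big/uniq_perm.
  - exact: fset_uniq.
  - exact: filter_uniq.
  move=> phi; rewrite mem_filter; apply/idP/andP => [h|[]//]; split=> //.
  by apply: contraTT h => /La0 e; rewrite mem_finsupp negbK e.
by move=> phi; rewrite mem_finsupp negbK => /eqP /f1.
Qed.

(** The order of GL(n,q) is q^(n(n-1)/2) prod (q^i - 1), so that q^n pi_n remains
    after division, and q^n is distributed over the phi by |La| = n. *)
Lemma plancherel_ptE n (La : LL F n) (s : seq (Phi F)) : uniq s ->
  (forall phi, phi \notin s -> val La phi = empty_intpart) ->
  plancherel_pt R La = euler_prod q n * \prod_(phi <- s) weight phi (val La phi).
Proof.
move=> us La0; rewrite /plancherel_pt /dim_irr -/q GLorderE.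
have sz : (\sum_(phi <- s) psize (val La phi) * deg phi = n)%N.
  rewrite -[RHS](eqP (valP La)) /csize; apply/esym/big_finsupp => // phi ->.
  by rewrite /psize /=.
rewrite natrM natrX natr_prod.
have -> : \prod_(1 <= i < n.+1) (#|F| ^ i - 1)%:R = \prod_(1 <= i < n.+1) (q ^+ i - 1) :> R.
  by apply: eq_bigr => i _; rewrite natrB ?natrX // expn_gt0 (ltn_trans _ (card_finNzRing_gt1 F)).
have -> : \prod_(1 <= i < n.+1) (q ^+ i - 1) = q ^+ (n + 'C(n, 2)) * euler_prod q n.
  rewrite /euler_prod; elim: n {La La0 sz} => [|n IH]; first by rewrite !big_geq // mulr1.
  rewrite [LHS]big_nat_recr // [in RHS]big_nat_recr //= [X in X * _ = _]IH.
  have -> : (n.+1 + 'C(n.+1, 2) = n + 'C(n, 2) + n.+1)%N by rewrite binS bin1; lia.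
  move: (n + 'C(n, 2))%N => a; rewrite exprD -!mulrA; congr (_ * _).
  rewrite [RHS]mulrCA; congr (_ * _).
  by rewrite mulrBr mulr1 divff // expf_neq0 // gt_eqF.
set A := \prod_(phi <- finsupp _) _.
have -> : A = \prod_(phi <- s) ((q ^+ deg phi) ^+ nstat (pconj (val La phi)) /
                                hookprod (q ^+ deg phi) (val La phi)).
  transitivity (\prod_(phi <- finsupp (val La)) ((q ^+ deg phi) ^+ nstat (pconj (val La phi)) /
                                hookprod (q ^+ deg phi) (val La phi))).
    apply: eq_bigr => phi _; rewrite -exprM mulnC.
    by congr (_ * _); apply: boxprodV => i j; rewrite -exprM mulnC.
  rewrite (big_finsupp _ us La0) // => phi ->.
  by rewrite nstat_pconj /= big_nil /hookprod /boxprod big_geq // mul1r invr1.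
have -> : \prod_(phi <- s) weight phi (val La phi) = q ^+ n *
   (\prod_(phi <- s) ((q ^+ deg phi) ^+ nstat (pconj (val La phi)) /
                      hookprod (q ^+ deg phi) (val La phi))) ^+ 2.
  have -> : q ^+ n = \prod_(phi <- s) q ^+ (psize (val La phi) * deg phi).
    by rewrite prodrXr sz.
  rewrite -prodrXl -big_split /=; apply: eq_bigr => phi _.
  rewrite /weight /pweight exprMn exprVn mulrA; congr (_ / _).
  by rewrite -!exprM -exprD; congr (_ ^+ _); lia.
have e0 := euler_prod_gt0 card_field_ge2 n.
rewrite exprD; set X := \prod_(phi <- s) _.
have c0 : q ^+ 'C(n, 2) != 0 by rewrite expf_neq0 // gt_eqF.
have n0 : q ^+ n != 0 by rewrite expf_neq0 // gt_eqF.
move: e0 c0 n0; rewrite lt0r => /andP[+ _].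
move: (q ^+ n) (q ^+ 'C(n, 2)) (euler_prod q n) => x y z z0 y0 x0; field.
by rewrite x0 y0 z0.
Qed.

Lemma phis_exists (n : nat) : exists s : seq (Phi F), forall phi, (deg phi <= n)%N -> phi \in s.
Proof.
exists (pmap insub (irrs F n)) => phi dn; rewrite mem_pmap_sub mem_irrs.
have /and3P[mp ip _] := valP phi; rewrite mp ip /=.
by apply: leq_trans (leqSpred _) _.
Qed.

Definition prescribed (k : nat) (phi : 'I_k -> Phi F) (lambda : 'I_k -> intpart)
    (psi : Phi F) (la : intpart) : bool :=
  [forall j, (phi j == psi) ==> (la == lambda j)].

(** Every phi in the support of a collection of size n has degree at most n, so a
    finite set s is large enough. *)
Lemma plancherel_cylinder n k (phi : 'I_k -> Phi F) (lambda : 'I_k -> intpart)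
    (s : seq (Phi F)) : uniq s -> (forall psi, (deg psi <= n)%N -> psi \in s) ->
  (forall j, phi j \in s) ->
  plancherel R [set La : LL F n | forall j : 'I_k, val La (phi j) = lambda j] =
  (euler_prod q n * conv_series weight (prescribed phi lambda) s n)%:E.
Proof.
move=> us sn phis; set C := [set La : LL F n | _].
have [L [uL memL <-]] := coll_inP weight (prescribed phi lambda) n us.
pose a (La : collection F) : \bar R :=
  (euler_prod q n * \prod_(phi <- s) weight phi (La phi))%:E.
have suppLL (La : LL F n) psi : psi \notin s -> val La psi = empty_intpart.
  move=> psis; apply/eqP; apply: contraNT psis => nz; apply: sn.
  have psiS : psi \in finsupp (val La) by rewrite mem_finsupp.
  have : (psize (val La psi) * deg psi <= n)%N.
    rewrite -[leqRHS](eqP (valP La)) /csize (big_fsetD1 psi) //=; exact: leq_addr.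
  apply: leq_trans; rewrite leq_pmull // lt0n; apply: contraNneq nz => z.
  apply/eqP/val_inj/nilP; rewrite /nilp -leqn0 -[X in (_ <= X)%N]z; exact: size_psize.
have -> : plancherel R C = \esum_(La in C) a (val La).
  apply: eq_esum => La _; congr (_%:E); apply: plancherel_ptE => //; exact: suppLL.
rewrite -esum_image; last by move=> x y _ _; exact: val_inj.
have -> : [set val x | x in C] = [set` L].
  apply/seteqP; split=> [_ [La CLa <-]|La /= /memL [La0 LaP sLa]].
    apply/memL; split=> [psi|psi psis|].
    - exact: suppLL.
    - by apply/forallP => j; apply/implyP => /eqP <-; apply/eqP; exact: CLa.
    - rewrite -[RHS](eqP (valP La)) /csize; apply/esym/big_finsupp => //.
        exact: suppLL.
      by move=> psi ->.
  have cs : csize La == n.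
    apply/eqP; rewrite -sLa; apply: big_finsupp => // psi -> .
    by rewrite /psize.
  exists (exist _ La cs) => // j /=.
  by have /forallP/(_ j) := LaP _ (phis j); rewrite eqxx => /eqP.
have a0 La : (0%R <= a La)%E.
  rewrite lee_fin mulr_ge0 ?(ltW (euler_prod_gt0 card_field_ge2 n)) //.
  by apply: prodr_ge0 => psi _; exact/pweight_ge0/deg_exp_gt1.
rewrite esum_fset; [|exact: finite_seq|by move=> La _; exact: a0].
by rewrite -(fsbig_seq _ _ uL) sumEFin mulr_sumr.
Qed.

(** Each prescribed partition contributes a monomial, which shifts the coefficients. *)
Lemma conv_series_fixed k (phi : 'I_k -> Phi F) (lambda : 'I_k -> intpart)
    (rest : seq (Phi F)) (r : seq 'I_k) n : injective phi ->
  conv_series weight (prescribed phi lambda) ([seq phi j | j <- r] ++ rest) n =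
  \prod_(j <- r) weight (phi j) (lambda j) *
  (let D := (\sum_(j <- r) deg (phi j) * psize (lambda j))%N in
   if (D <= n)%N then conv_series weight (prescribed phi lambda) rest (n - D) else 0).
Proof.
move=> phiI /=; elim: r n => [|j r IH] n; first by rewrite !big_nil mul1r subn0.
rewrite !big_cons /=; set cs := conv_series _ _; set d := deg (phi j).
set W := weight (phi j) (lambda j); set m := (d * psize (lambda j))%N.
have d0 : (0 < d)%N by exact: deg_gt0.
have ps i : dilate d (part_series weight (prescribed phi lambda) (phi j)) i =
    if i == m then W else 0.
  have presE la : prescribed phi lambda (phi j) la = (la == lambda j).
    apply/forallP/eqP => [/(_ j)|-> i']; first by rewrite eqxx => /eqP.
    by apply/implyP => /eqP /phiI ->.
  have psE l : part_series weight (prescribed phi lambda) (phi j) l =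
      if l == psize (lambda j) then W else 0.
    rewrite /part_series (eq_bigl (pred1 (lambda j))) //.
    case: eqP => [e|ne].
      by rewrite -big_filter filter_pred1_uniq ?intparts_uniq ?big_seq1 // mem_intparts e.
    rewrite big1_seq // => la /andP[/eqP -> ]; rewrite mem_intparts => /eqP e.
    by case: ne.
  rewrite /dilate psE; case: ifP => [/dvdnP[l ->]|di].
    by rewrite mulnK // /m mulnC eqn_pmul2l.
  by case: eqP => // im; rewrite im /m dvdn_mulr in di.
rewrite /conv; case: (leqP m n) => [mn|nm]; last first.
  rewrite big1 => [|i _]; first by rewrite ifF ?mulr0 //; lia.
  by rewrite ps ifF ?mul0r //; have := ltn_ord i; lia.
rewrite (bigD1 (Ordinal (mn : (m < n.+1)%N))) //= ps eqxx big1 ?addr0 => [|i im]; last first.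
  by rewrite ps ifF ?mul0r //; apply: contraNF im => /eqP im; apply/eqP/val_inj.
rewrite /cs IH -mulrA; congr (_ * (_ * _)).
by rewrite leq_subRL // subnDA.
Qed.

Lemma conv_series_free k (phi : 'I_k -> Phi F) (lambda : 'I_k -> intpart)
    (rest : seq (Phi F)) : (forall j, phi j \notin rest) ->
  newton (fun m => \sum_(psi <- rest | (deg psi %| m)%N)
                     (deg psi)%:R * (q ^- m / (1 - q ^- m) ^+ 2))
    (conv_series weight (prescribed phi lambda) rest).
Proof.
elim: rest => [|psi rest IH] phin.
  split=> // n; rewrite /nderiv /= mulr0 /conv big1 // => i _ /=.
  by rewrite big_nil mul0r.
have free la : prescribed phi lambda psi la.
  apply/forallP => j; apply/implyP => /eqP e.
  by have := phin j; rewrite e mem_head.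
have phin' j : phi j \notin rest.
  by have := phin j; rewrite inE negb_or => /andP[].
have := newton_conv (newton_dilate (deg_gt0 psi) (pweight_sum_newton (deg_exp_gt1 psi)))
  (IH phin').
have -> : dilate (deg psi) (pweight_sum (q ^+ deg psi)) =
    dilate (deg psi) (part_series weight (prescribed phi lambda) psi).
  congr dilate; apply/funext => l; rewrite /pweight_sum /part_series.
  by apply: eq_bigl => la; rewrite free.
congr newton; apply/funext => m /=; rewrite big_cons /dilate.
case: ifP => [/dvdnP[l ->]|_]; last by rewrite mulr0 add0r.
by rewrite mulnK ?deg_gt0 // -!exprVn -!exprM mulnC.
Qed.

End Plancherel.

Theorem theorem1 (R : realType) (F : finFieldType) (k : nat) (hk : (1 <= k)%N)
    (lambda : 'I_k -> intpart) (phi : 'I_k -> Phi F) (hphi : injective phi) :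
  (fun n : nat => plancherel R [set La : LL F n |
                    forall j : 'I_k, val La (phi j) = lambda j]) @ \oo -->
  (\prod_(j < k) M 1 (#|F|%:R ^+ deg (phi j)) (lambda j) : R)%:E.
Proof.
pose q : R := #|F|%:R; have q2 : 2 <= q by exact: card_field_ge2.
pose D := (\sum_(j < k) deg (phi j) * psize (lambda j))%N.
pose W := \prod_(j < k) weight R (phi j) (lambda j).
have dphi j : (0 < deg (phi j))%N by exact: deg_gt0.
have [A AN] := newton_exists (removed_powers q (fun j => deg (phi j))).
have [l l0 el] := cvg_euler_prod q2.
have Al := cvg_removed q2 dphi AN el l0.
have muE n : (D <= n)%N -> plancherel R [set La : LL F n |
    forall j : 'I_k, val La (phi j) = lambda j] = (euler_prod q n * (W * A (n - D)%N))%:E.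
  move=> Dn; have [s0 s0P] := phis_exists F n.
  pose T := [seq phi j | j <- enum 'I_k].
  pose rest := [seq psi <- undup s0 | psi \notin T].
  have uT : uniq T by rewrite map_inj_uniq ?enum_uniq.
  have us : uniq (T ++ rest).
    rewrite cat_uniq uT filter_uniq ?undup_uniq // andbT /=.
    by apply/hasPn => psi; rewrite mem_filter => /andP[].
  have sP psi : (deg psi <= n)%N -> psi \in T ++ rest.
    by move=> /s0P h; rewrite mem_cat mem_filter mem_undup h andbT orbN.
  have phiT j : phi j \in T by apply: map_f; rewrite mem_enum.
  rewrite (plancherel_cylinder R lambda us sP); last by move=> j; rewrite mem_cat phiT.
  rewrite (conv_series_fixed R lambda rest (enum 'I_k) n hphi) /=.
  rewrite !big_enum /= -/D Dn; congr ((_ * (_ * _))%:E).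
  have phirest j : phi j \notin rest by rewrite mem_filter phiT.
  apply: (newton_eq (conv_series_free _ _ phirest) AN) => m /andP[m0 mn].
  have mn' : (0 < m <= n)%N by rewrite m0 (leq_trans mn) ?leq_subr.
  set x := q ^- m.
  have xlt : x < 1 by exact: qexp_lt1.
  (* The degrees in T and rest add up to q^m - 1, and those in T are subtracted. *)
  have tot := sum_Phi_degrees us sP mn'.
  rewrite big_cat /= in tot.
  rewrite /removed_powers -/x -mulr_suml -natr_sum.
  have -> : \sum_(j < k) (deg (phi j))%:R * dilate (deg (phi j))
     (fun i => (q ^+ deg (phi j)) ^- i / (1 - (q ^+ deg (phi j)) ^- i) ^+ 2) m =
     (\sum_(psi <- T | (deg psi %| m)%N) deg psi)%N%:R * (x / (1 - x) ^+ 2).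
    rewrite /T big_map big_enum_cond /= natr_sum mulr_suml [RHS]big_mkcond /=.
    apply: eq_bigr => j _; rewrite /dilate; case: ifP => [/dvdnP[i mi]|_]; last by rewrite mulr0.
    rewrite /x mi mulnK //; congr (_ * (_ / (1 - _) ^+ 2)); by rewrite -!exprVn -!exprM mulnC.
  have tot' : (\sum_(psi <- T | (deg psi %| m)%N) deg psi)%N%:R +
     (\sum_(psi <- rest | (deg psi %| m)%N) deg psi)%N%:R = x^-1 - 1.
    rewrite -natrD tot natrB ?expn_gt0 ?(ltn_trans _ (card_finNzRing_gt1 F)) //.
    by rewrite natrX /x invrK.
  have x0 : x != 0 by rewrite invr_eq0 expf_neq0 // gt_eqF //; lra.
  have x1 : 1 - x != 0 by rewrite subr_eq0 gt_eqF.
  move/(canRL (addKr _)): tot' => ->.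
  by move: (_%:R) => t; field; rewrite x0 x1.
rewrite -(cvg_shiftn D).
under eq_fun do rewrite muE ?leq_addl // addnK.
apply: cvg_EFin; first exact: nearW.
have -> : \prod_(j < k) M 1 (#|F|%:R ^+ deg (phi j)) (lambda j) =
   l * (W * ((\prod_(j < k) limn (Mfactor 1 (q ^+ deg (phi j)))) * l^-1)) :> R.
  rewrite mulrCA [X in _ = _ * X]mulrCA divff ?mulr1 ?gt_eqF //.
  rewrite /W -big_split /=; apply: eq_bigr => j _.
  rewrite /M expr1n mulr1 -[LHS]mulrA [LHS]mulrC /weight /pweight; congr (_ * _ * _).
  rewrite (@boxprodV R (lambda j) (fun i i' =>
     ((q ^+ deg (phi j)) ^+ hook (lambda j) i i' - 1) ^+ 2)) //.
  congr GRing.inv; rewrite /hookprod /boxprod -prodrXl; apply: eq_bigr => i _.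
  by rewrite -prodrXl.
rewrite (_ : fine \o _ = fun n => euler_prod q (n + D) * (W * A n)) //.
apply: cvgM; first by rewrite (cvg_shiftn D (euler_prod q)).
by apply: cvgM => //; exact: cvg_cst.
Qed.
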